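(* Let $D\subset\mathbb{RP}^2$ be a connected, reduced, alternating diagram for an oriented, non-split, non-local alternating link $L$ in $\mathbb{RP}^3$, and let $G_+$ and $G_-$ be its two checkerboard (Tait) graphs. Then there are $k_+,k_-\in\mathbb{Z}[\tfrac12]$ such that $$J_L(t)=(-1)^{w(D)}\left(t^{k_+}\,\psi_{G_+}(-t,-t^{-1})+t^{k_-}\,\psi_{G_-}(-t^{-1},-t)\right)$$ and $k_+-k_-=\tfrac12$.
   Context: Links in $\mathbb{RP}^3$ are represented by diagrams $D\subset\mathbb{RP}^2$ ($\mathbb{RP}^3$ minus a point is a twisted interval bundle over $\mathbb{RP}^2$), drawn in a disk with antipodal boundary points identified, over/under information as seen in the disk. A link is local if it lies in a 3-ball in $\mathbb{RP}^3$, nullhomologous if its class in $H_1(\mathbb{RP}^3;\mathbb{Z}/2)$ is $0$. A diagram is alternating if, for any two successive crossings along it, over/under alternates if and only if the arc between them passes through the disk's boundary an even number of times (possibly zero); a link is alternating if it has such a diagram (it is then nullhomologous). Diagrams of nullhomologous links are checkerboard colorable. For each of the two colorings, the Tait graph, embedded in $\mathbb{RP}^2$, has one vertex per black region and one edge per crossing. An edge is signed $+$ if rotating the over-strand counterclockwise at the crossing sweeps out the black regions, and $-$ otherwise. For a connected alternating diagram all edges of one Tait graph are $+$ (this is $G_+$) and all edges of the other are $-$ (this is $G_-$). A diagram is reduced if no edge of its Tait graphs is a bridge or a loop bounding a disk in $\mathbb{RP}^2$. Jones polynomial: the Kauffman bracket of a diagram of a nullhomologous link is defined by $\langle\text{crossing}\rangle=A\langle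 A\text{-smoothing}\rangle+A^{-1}\langle B\text{-smoothing}\rangle$ (the $A$-smoothing joins the two regions swept by rotating the over-strand counterclockwise), $\langle D\sqcup\bigcirc\rangle=(-A^2-A^{-2})\langle D\rangle$ for a crossingless null-homotopic circle, and value $1$ on a single such circle. $J_L(t)=(-A^3)^{-w(D)}\langle D\rangle|_{A=t^{-1/4}}$, with $w(D)$ the writhe. Myopic Tutte polynomial: for a graph $G$ embedded in $\mathbb{RP}^2$, $\psi_G\in\mathbb{Z}[x,y]$ is defined recursively by: $\psi_G=\psi_{G-e}+\psi_{G/e}$ if $e$ is neither a bridge nor a loop; $\psi_G=x\,\psi_{G/e}$ if $e$ is a bridge; $\psi_G=y\,\psi_{G-e}$ if $e$ is a loop with $[e]=0\in H_1(\mathbb{RP}^2)$; $\psi_G=\psi_{G-e}$ if $e$ is a loop with $[e]\neq0\in H_1(\mathbb{RP}^2)$; $\psi_G=1$ if $G$ has no edges. *)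

(* Defs.v *)
From Stdlib Require Import Relations.
From HB Require Import structures.
From mathcomp Require Import all_boot all_order all_algebra.
From mathcomp Require Export fraction polyXY.

Set Implicit Arguments.
Unset Strict Implicit.
Unset Printing Implicit Defensive.

Import Order.TTheory GRing.Theory Num.Theory.
Local Open Scope ring_scope.

(** * Link diagrams in RP^2

   RP^2 is a disk with antipodal boundary points identified.  A diagram is
   recorded by its planar-diagram code.  The four half-arcs at a crossing c are
   (c, 0), ..., (c, 3), in counterclockwise order as seen in the disk, with
   (c, 0) and (c, 2) on the under-strand, (c, 1) and (c, 3) on the over-strand.
   [mate] matches the two ends of each arc, and [flip] says whether that arc
   passes through the boundary of the disk an odd number of times.  Components
   without crossings are only counted, according to their homotopy class. *)
Record pd_code := PDCode {
  crossing : finType;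
  mate : crossing * 'I_4 -> crossing * 'I_4;
  flip : crossing * 'I_4 -> bool;
  null_circles : nat;
  essential_circles : nat }.

Notation dart D := (crossing D * 'I_4)%type.

Section PDCode.
Variable D : pd_code.
Implicit Types (d k : dart D) (c : crossing D).

Definition ccw d : dart D := (d.1, d.2 + 1).
Definition cw d : dart D := (d.1, d.2 - 1).
Definition opposite d : dart D := (d.1, d.2 + 2%:R).
Definition is_over d : bool := odd d.2.

(* A half-arc k also names the corner of its crossing lying between k and
   [ccw k].  [along_left k] is reached from that corner by following the arc
   of k, along its counterclockwise side (seen from k), up to its other end,
   and [along_right k] by following the arc of [ccw k] along its clockwise
   side.  The two sides of an arc, as seen in the disk, are exchanged whenever
   the arc passes through the boundary. *)
Definition along_left k : dart D :=
  if flip k then mate k else cw (mate k).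
Definition along_right k : dart D :=
  if flip (ccw k) then cw (mate (ccw k)) else mate (ccw k).

Definition same_region : rel (dart D) :=
  [rel k k' | (k' == along_left k) || (k' == along_right k)].

Definition joined : rel (crossing D) :=
  [rel c c' | [exists i : 'I_4, (mate (c, i)).1 == c']].

(* The condition for an abstract code to be that of a diagram in RP^2.  Gluing
   a disk along each region boundary turns each connected piece of the
   underlying 4-valent graph into a closed surface, and the Euler
   characteristics (vertices - edges + faces, with twice as many edges as
   vertices) add up to faces - vertices.  As each of them is at most 2, the
   inequality says that all these surfaces are spheres, except that at most one
   is a projective plane, and that there is at most one such surface or
   essential circle: disjoint pieces of a diagram in RP^2 cannot both be
   essential, and the others lie in disks.  Their position with respect to the
   other pieces is not recorded: it does not affect the link. *)
Definition drawn_on_RP2 : bool :=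
  (2 * n_comp joined predT + #|crossing D| + essential_circles D
     <= n_comp same_region predT + 1)%N.

Definition pd_axiom : Prop :=
  [/\ involutive (@mate D), forall d, mate d != d,
      forall d, flip (mate d) = flip d & drawn_on_RP2].

End PDCode.

Record diagram := Diagram { code :> pd_code; codeP : pd_axiom code }.

Section Diagram.
Variable D : diagram.

Definition pieces : nat :=
  (n_comp (@joined D) predT + null_circles D + essential_circles D)%N.

Definition connected_diagram : Prop := pieces = 1%N.

(* The diagram lies in the interior of the disk, up to isotopy: if each arc
   passes through the boundary of the disk an even number of times, all closed
   curves in the diagram are null-homotopic in RP^2, so that the boundary can be
   moved off the diagram. *)
Definition diagram_in_disk : Prop :=
  (forall d : dart D, ~~ flip d) /\ essential_circles D = 0%N.

(* The class in H_1(RP^3; Z/2) is the number of intersections with the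
   boundary line mod 2; each arc has two ends. *)
Definition nullhomologous : bool :=
  ~~ odd (#|[set d : dart D | flip d]|./2 + essential_circles D).

Definition alternating_diagram : Prop :=
  forall d : dart D, (is_over d != is_over (mate d)) = ~~ flip d.

(* [o d] says that the strand leaves the crossing d.1 through d.  Crossingless
   circles do not contribute to the writhe: their orientations are omitted. *)
Definition orientation (o : dart D -> bool) : Prop :=
  forall d : dart D, o (mate d) = ~~ o d /\ o (opposite d) = ~~ o d.

(* With the under-strand leaving through (c, 2), the crossing is positive iff
   the over-strand leaves through (c, 1), i.e. iff the over-strand has to be
   turned counterclockwise by a right angle to get the under-strand. *)
Definition writhe (o : dart D -> bool) : int :=
  \sum_(c : crossing D) (if o (c, 1) == o (c, 2%:R) then 1 else -1).

(** * Checkerboard colorings and Tait graphs *)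

(* [black k] is the color of the region containing the corner k. *)
Definition checkerboard (black : dart D -> bool) : Prop :=
  (forall k k', same_region k k' -> black k = black k')
  /\ (forall k, black (ccw k) = ~~ black k).

(* Turned counterclockwise, the over-strand sweeps the corners (c, 1) and
   (c, 3). *)
Definition edge_positive (black : dart D -> bool) (c : crossing D) : bool :=
  black (c, 1).

Definition region (k : dart D) : dart D := fingraph.root (@same_region D) k.

(* Parity of the number of times that a path inside the region of k, from its
   base corner [region k] to k, passes through the boundary of the disk: this
   is read off in the double cover S^2 of RP^2.  It is independent of the path
   as soon as the region is a disk. *)
Definition same_region_lift : rel (dart D * bool) :=
  [rel p q | (q == (along_left p.1, p.2 (+) flip p.1))
          || (q == (along_right p.1, p.2 (+) flip (ccw p.1)))].
Definition region_parity (k : dart D) : bool :=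
  connect same_region_lift (region k, false) (k, true).

End Diagram.

(** * Links in RP^3, as diagrams up to Reidemeister moves

   Orientations are left out, as being local or split does not involve them. *)

(* Planar isotopy (eps = false everywhere), and pushing through the boundary of
   the disk the crossings c with [eps c]: this reverses the cyclic order,
   exchanges over and under, and changes the parity of the incident half-arcs.
   Pushing only an arc through the boundary does not change the code. *)
Definition isotopy_move (D D' : diagram) : Prop :=
  exists (eps : crossing D -> bool) (phi : dart D -> dart D'),
  [/\ bijective phi,
      forall d, phi (ccw d) = if eps d.1 then cw (phi d) else ccw (phi d),
      forall d, is_over (phi d) = is_over d (+) eps d.1,
      forall d, phi (mate d) = mate (phi d)
        /\ flip (phi d) = flip d (+) eps d.1 (+) eps (mate d).1
    & null_circles D' = null_circles D
      /\ essential_circles D' = essential_circles D].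

Section Removal.
Variables (D : diagram) (S : {set crossing D}).

Definition strand : rel (dart D) := [rel d d' | (d' == mate d) || (d' == opposite d)].
Definition strand_lift : rel (dart D * bool) :=
  [rel p q | (q == (mate p.1, p.2 (+) flip p.1)) || (q == (opposite p.1, p.2))].
Definition component_within (d : dart D) : bool :=
  [forall d', connect strand d d' ==> (d'.1 \in S)].
Definition essential_component (d : dart D) : bool :=
  connect strand_lift (d, false) (d, true).

(* Leaving through d, the strand comes to its n-th next crossing through the
   half-arc [arrival d n]. *)
Definition arrival (d : dart D) (n : nat) : dart D :=
  iter n (fun d' => mate (opposite d')) (mate d).

(* D' is obtained from D by erasing the crossings of S, the strands going
   straight through them; link components with all their crossings in S become
   crossingless circles. *)
Definition removal (D' : diagram) : Prop :=
  exists phi : crossing D' -> crossing D,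
  let phid (d : dart D') : dart D := (phi d.1, d.2) in
  [/\ injective phi,
      forall c, (c \in codom phi) = (c \notin S),
      forall d : dart D', exists n : nat,
        [/\ forall j, (j < n)%N -> (arrival (phid d) j).1 \in S,
            arrival (phid d) n = phid (mate d)
          & flip d = odd (\sum_(j < n.+1) flip (arrival (phid d) j))%N],
      null_circles D' = (null_circles D
        + n_comp strand [pred d | component_within d && ~~ essential_component d])%N
    & essential_circles D' = (essential_circles D
        + n_comp strand [pred d | component_within d && essential_component d])%N].

End Removal.

(* The corner x is a monogon. *)
Definition R1_move (D D' : diagram) : Prop :=
  exists x : dart D,
  [/\ mate (ccw x) = x, ~~ flip x & removal [set x.1] D'].

(* The corners x and y are those of a bigon, and the strand containing the arc
   from [ccw x] to y is above, or below, the other one at both crossings. *)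
Definition R2_move (D D' : diagram) : Prop :=
  exists x y : dart D,
  [/\ x.1 != y.1, mate (ccw x) = y /\ mate (ccw y) = x,
      ~~ flip x /\ ~~ flip y,
      is_over (ccw x) = is_over y & removal [set x.1; y.1] D'].

(* The corners x, y, z are those of a triangle, and the strand containing the
   arc from [ccw x] to y is above the two others.  Moving the strands past each
   other keeps the directions at each crossing, and exchanges the order of the
   two crossings on each strand: with [inner] the half-arcs of the triangle, the
   effect on the matching is conjugation by the involution [swap]. *)
Definition R3_move (D D' : diagram) : Prop :=
  exists x y z : dart D,
  let inner := [:: x; ccw x; y; ccw y; z; ccw z] in
  let swap d := if d \in inner then opposite (mate d)
                else if opposite d \in inner then mate (opposite d) else d in
  [/\ uniq [:: x.1; y.1; z.1],
      [/\ mate (ccw x) = y, mate (ccw y) = z & mate (ccw z) = x],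
      [/\ ~~ flip x, ~~ flip y & ~~ flip z],
      is_over (ccw x) && is_over y
    & exists phi : crossing D' -> crossing D,
      let phid (d : dart D') : dart D := (phi d.1, d.2) in
      [/\ bijective phi,
          forall d, phid (mate d) = swap (mate (swap (phid d))),
          forall d, flip d = flip (swap (phid d)),
          null_circles D' = null_circles D
        & essential_circles D' = essential_circles D]].

Definition reidemeister_move (D D' : diagram) : Prop :=
  [\/ isotopy_move D D', R1_move D D', R2_move D D' | R3_move D D'].

Definition same_link : diagram -> diagram -> Prop :=
  clos_refl_sym_trans diagram reidemeister_move.

(* The link represented by D lies in a ball: it can be drawn inside the disk. *)
Definition local_link (D : diagram) : Prop :=
  exists D', same_link D D' /\ diagram_in_disk D'.

(* A sphere separating two parts of the link bounds a ball: the part in the ball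
   can be drawn apart from the other one. *)
Definition split_link (D : diagram) : Prop :=
  exists D', same_link D D' /\ (1 < pieces D')%N.

(** * Jones polynomial *)

Section Jones.
Variables (K : fieldType) (A : K) (D : diagram).

(* The strands of the smoothing at a crossing: the A-smoothing (a = true) joins
   the corners (c, 1) and (c, 3), hence connects 0 with 1 and 2 with 3. *)
Definition smooth (a : bool) (d : dart D) : dart D :=
  if is_over d == a then cw d else ccw d.

Definition state_circles (s : crossing D -> bool) : nat :=
  (n_comp [rel d d' | (d' == mate d) || (d' == smooth (s d.1) d)] predT
   + null_circles D + essential_circles D)%N.

(* The bracket of D with the crossings in cs still to be smoothed, the others
   being smoothed according to s.  For a nullhomologous link all the circles of
   a full smoothing are null-homotopic. *)
Fixpoint bracket_rec (cs : seq (crossing D)) (s : crossing D -> bool) : K :=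
  if cs is c :: cs' then
    A * bracket_rec cs' [eta s with c |-> true]
    + A^-1 * bracket_rec cs' [eta s with c |-> false]
  else (- A ^+ 2 - A ^- 2) ^+ (state_circles s).-1.

Definition bracket : K := bracket_rec (enum (crossing D)) (fun=> true).

(* In terms of A = t^(-1/4). *)
Definition jones (o : dart D -> bool) : K :=
  (- A ^+ 3) ^ (- writhe o) * bracket.

End Jones.

(** * Graphs in RP^2 and the myopic Tutte polynomial *)

(* A graph embedded in RP^2, remembered through the map it induces from H_1 of
   the graph to H_1(RP^2) = Z/2: [odd_edge e] is the parity of the number of
   times e passes through the boundary of the disk, so that the class of a
   cycle is the sum of the parities of its edges. *)
Record graphRP2 (V E : finType) := GraphRP2 {
  vertices : {set V};
  edges : {set E};
  src : E -> V;
  tgt : E -> V;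
  odd_edge : E -> bool }.

Section Myopic.
Variables V E : finType.
Implicit Types (G : graphRP2 V E) (e : E).

Definition adjacent G : rel V :=
  [rel u v | [exists e in edges G,
     ((src G e == u) && (tgt G e == v)) || ((src G e == v) && (tgt G e == u))]].

Definition delete G e : graphRP2 V E :=
  GraphRP2 (vertices G) (edges G :\ e) (src G) (tgt G) (odd_edge G).

(* For e not a loop: if e is odd, its target is first pushed through the
   boundary of the disk, which changes the parity of each half-edge there; then
   the target of e is merged into its source. *)
Definition contract G e : graphRP2 V E :=
  let merge v := if v == tgt G e then src G e else v in
  GraphRP2 (vertices G :\ tgt G e) (edges G :\ e)
    (fun f => merge (src G f)) (fun f => merge (tgt G f))
    (fun f => odd_edge G f (+) (odd_edge G e
       && ((src G f == tgt G e) (+) (tgt G f == tgt G e)))).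

Definition is_loop G e : bool := src G e == tgt G e.
Definition is_bridge G e : bool :=
  ~~ connect (adjacent (delete G e)) (src G e) (tgt G e).

(* In RP^2, a loop bounds a disk iff its class vanishes. *)
Definition is_trivial_loop G e : bool := is_loop G e && ~~ odd_edge G e.

(* [myopic_tutte G p]: the recursion, applied to the edges of G in some order,
   computes p as the value of psi_G; the variable x is 'X and y is 'Y. *)
Inductive myopic_tutte : graphRP2 V E -> {poly {poly int}} -> Prop :=
| MyopicEmpty G : edges G = set0 -> myopic_tutte G 1
| MyopicOrdinary G e p q : e \in edges G -> ~~ is_bridge G e -> ~~ is_loop G e ->
    myopic_tutte (delete G e) p -> myopic_tutte (contract G e) q ->
    myopic_tutte G (p + q)
| MyopicBridge G e p : e \in edges G -> is_bridge G e ->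
    myopic_tutte (contract G e) p -> myopic_tutte G ('X * p)
| MyopicTrivialLoop G e p : e \in edges G -> is_loop G e -> ~~ odd_edge G e ->
    myopic_tutte (delete G e) p -> myopic_tutte G ('Y * p)
| MyopicEssentialLoop G e p : e \in edges G -> is_loop G e -> odd_edge G e ->
    myopic_tutte (delete G e) p -> myopic_tutte G p.

Lemma myopic_tutte_exists G : exists p, myopic_tutte G p.
Proof.
have [n] := ubnP #|edges G|; elim: n => // n IHn in G *.
have [E0 _|[e eG]] := set_0Vmem (edges G); first by exists 1; apply: MyopicEmpty.
rewrite (cardsD1 e) eG ltnS => ltn.
have [p pP] := IHn (delete G e) ltn; have [q qP] := IHn (contract G e) ltn.
have [bG|bG] := boolP (is_bridge G e).
  by exists ('X * q); apply: MyopicBridge bG qP.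
have [lG|lG] := boolP (is_loop G e); last first.
  by exists (p + q); apply: MyopicOrdinary bG lG pP qP.
have [oG|oG] := boolP (odd_edge G e).
  by exists p; apply: MyopicEssentialLoop lG oG pP.
by exists ('Y * p); apply: MyopicTrivialLoop lG oG pP.
Qed.

End Myopic.

(* A region is represented by its base corner.  The edge of a crossing c joins
   the regions of the two black corners at c, (c, 1) and (c, 3), or (c, 0) and
   (c, 2). *)
Definition black_corner (D : diagram) (black : dart D -> bool) (c : crossing D) :
  dart D := (c, if black (c, 1) then 1 else 0).

Definition tait (D : diagram) (black : dart D -> bool) :
    graphRP2 (dart D) (crossing D) :=
  let k c := black_corner black c in
  GraphRP2 [set region k' | k' in [pred k' | black k']] [set: crossing D]
    (fun c => region (k c)) (fun c => region (opposite (k c)))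
    (fun c => region_parity (k c) (+) region_parity (opposite (k c))).

Definition reduced (D : diagram) : Prop :=
  forall black : dart D -> bool, checkerboard black ->
  forall c : crossing D,
    ~~ is_bridge (tait black) c /\ ~~ is_trivial_loop (tait black) c.

(* The two colorings of an alternating diagram. *)
Lemma alternating_checkerboard (D : diagram) : alternating_diagram D ->
  checkerboard (fun k : dart D => is_over k)
  /\ checkerboard (fun k : dart D => ~~ is_over k).
Proof.
move=> altD; have overS (d : dart D) : is_over (ccw d) = ~~ is_over d.
  by case: d => c [[|[|[|[|i]]]] //= ltr].
have overV (d : dart D) : is_over (cw d) = ~~ is_over d.
  by case: d => c [[|[|[|[|i]]]] //= ltr].
have overR (k k' : dart D) : same_region k k' -> is_over k = is_over k'.
  rewrite /same_region /= => /orP[] /eqP->; rewrite /along_left /along_right.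
    by have := altD k; case: (flip k); rewrite ?overV; do 2 case: (is_over _).
  have := altD (ccw k); rewrite overS.
  by case: (flip _); rewrite ?overV; do 2 case: (is_over _).
by split; split => [k k' /overR->|k] //; rewrite overS.
Qed.

(** * Powers of t with exponents in Z[1/2] *)

(* Z[1/2] *)
Definition dyadic (k : rat) : Prop := exists m : nat, k * 2%:R ^+ m \is a Num.int.

(* t^k in the field of fractions of Z[t^(1/2^m)], with 'X for t^(1/2^m); it is
   meaningful for k * 2^m an integer. *)
Definition tpow (m : nat) (k : rat) : {fraction {poly int}} :=
  (tofrac 'X) ^ (Num.floor (k * 2%:R ^+ m)).

Definition eval2 (K : fieldType) (p : {poly {poly int}}) (x y : K) : K :=
  (map_poly (map_poly (intr : int -> K)) p).[x, y].

(* Main.v *)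
Require Import Defs.
From mathcomp Require Import all_boot all_order all_algebra.
From mathcomp Require Import zify ring.

(* Expand the bracket over the sets H of A-smoothed crossings.  With V the number
   of vertices of G_+, k(H) the number of components of (V, H) and k~(H) that of
   its lift to S^2, the state H has c(H) circles, and
   2 k(H) + |H| - V - c(H) can only grow with H: changing one smoothing changes
   c by at most 1, and joins two circles if it joins two components.  In RP^2
   this excess goes from 0 (H empty) to 1 (H full), unless the diagram is local;
   in S^2 it is constantly 0, which gives c(H) = k~(H) + |H| - V.  So
   2 k(H) - k~(H), the number of components of H containing an essential cycle,
   is 0 or 1.  For the complement of H in G_- it is the opposite, by parity:
   exactly one of the two subgraphs is balanced (without essential cycle).

   The states with H balanced in G_+ contribute the sum of
   A^(2|H| - |E|) d^(2 k(H) + |H| - V - 1) over the balanced H, where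
   d = - A^2 - A^-2, and this sum obeys the recursion of psi(-A^-4, -A^4) up to
   a power of A.  The other states give in the same way the sum for G_-, with
   A^-1 instead of A.  The exponents differ by 1/2 since |V_+| + |V_-| = |E| + 1. *)

Import Order.TTheory GRing.Theory Num.Theory.
Local Open Scope ring_scope.

Set Implicit Arguments.
Unset Strict Implicit.
Unset Printing Implicit Defensive.

Local Notation croot := fingraph.root.

(** * Counting connected components *)

Lemma connect_preserve (T : finType) (S : eqType) (e : rel T) (f : T -> S) :
  (forall x y, e x y -> f x = f y) -> forall x y, connect e x y -> f x = f y.
Proof.
move=> ef x y /connectP[p]; elim: p x => [x _ -> //|z p IHp x] /=.
by case/andP=> /ef fxz ep yz; rewrite fxz; apply: IHp.
Qed.

Lemma card_imset_kernel (T S S' : finType) (A : {pred T}) (f : T -> S)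
    (g : T -> S') :
  {in A &, forall x y, (f x == f y) = (g x == g y)} -> #|f @: A| = #|g @: A|.
Proof.
move=> fg; have [A0|[x0 Ax0]] := set_0Vmem [set x in A].
  suff E (R : finType) (h : T -> R) : h @: A = set0 by rewrite !E !cards0.
  apply/setP => z; rewrite inE; apply/imsetP => -[x Ax _].
  by have := in_set0 x; rewrite -A0 inE Ax.
(* [h] is a section of [f] over its image, [x0] being a mere default; [g] after [h] then carries one
   image bijectively onto the other. *)
pose h y := odflt x0 [pick x | (x \in A) && (f x == y)].
have hf x : x \in A -> h (f x) \in A /\ f (h (f x)) = f x.
  move=> Ax; rewrite /h; case: pickP => [z /andP[Az /eqP->] //|/(_ x)].
  by rewrite Ax eqxx.
have <- : (fun y => g (h y)) @: (f @: A) = g @: A.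
  apply/setP => z; apply/imsetP/imsetP => [[_ /imsetP[x Ax ->] ->]|[x Ax ->]].
    by exists (h (f x)) => //; case: (hf x Ax).
  exists (f x); first exact: imset_f.
  by have [Ah fh] := hf x Ax; apply/eqP; rewrite -fg // fh.
apply/esym/eqP/imset_injP => _ _ /imsetP[x Ax ->] /imsetP[y Ay ->] /eqP.
have [Ahx fhx] := hf x Ax; have [Ahy fhy] := hf y Ay.
by rewrite -fg // fhx fhy => /eqP.
Qed.

(** Turns the counting of components into the cardinal of an image, with freedom in the choice of
    the complete invariant [f]. *)
Lemma n_comp_kernel (T S : finType) (e : rel T) (a : {pred T}) (f : T -> S) :
    connect_sym e -> closed e a ->
    {in a &, forall x y, connect e x y = (f x == f y)} ->
  n_comp e a = #|f @: a|.
Proof.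
move=> sym_e cl_a ef; rewrite -(@card_imset_kernel _ _ _ a (croot e)); last first.
  by move=> x y ax ay; rewrite -ef // root_connect.
apply: eq_card => x; rewrite !inE; apply/andP/imsetP => [[/eqP rx ax]|[y ay ->]].
  by exists x.
by rewrite roots_root // -(closed_connect cl_a (connect_root e y)).
Qed.

Lemma n_comp_root (T : finType) (e : rel T) (a : {pred T}) :
  connect_sym e -> closed e a -> n_comp e a = #|croot e @: a|.
Proof.
by move=> sym_e cl_a; apply: n_comp_kernel => // x y _ _; rewrite root_connect.
Qed.

(** The assumptions make [h] bijective on components. Half-arcs, regions and crossings, which live
    in different types, are compared in this way. *)
Lemma n_comp_retract (T T' : finType) (e : rel T) (e' : rel T') (a : {pred T})
    (h : T' -> T) :
    connect_sym e -> connect_sym e' -> closed e a -> (forall x, h x \in a) ->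
    (forall x y, connect e' x y = connect e (h x) (h y)) ->
    {in a, forall x, exists y, connect e x (h y)} ->
  n_comp e a = n_comp e' predT.
Proof.
move=> sym_e sym_e' cl_a ha he hs; rewrite n_comp_root //.
rewrite (@n_comp_kernel _ _ e' predT (fun x => croot e (h x))) //; last first.
  by move=> x y _ _; rewrite root_connect.
apply: eq_card => z; apply/imsetP/imsetP => [[x ax ->]|[y _ ->]].
  by have [y /(fingraph.rootP sym_e) ->] := hs x ax; exists y.
by exists (h y).
Qed.

Section AddEdge.
Variables (T : finType) (e e' : rel T) (x y : T).
Hypotheses (sym_e : connect_sym e) (sym_e' : connect_sym e').
Hypotheses (sub_ee' : subrel e (connect e')) (e'xy : connect e' x y).
Hypothesis e'P : forall u v, e' u v ->
  [\/ connect e u v, connect e u x /\ connect e v y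
    | connect e u y /\ connect e v x].

(** Representative of the [e']-class of [z]: its [e]-root, with the class of [x] renamed to that of
    [y]. *)
Let g z := if croot e z == croot e x then croot e y else croot e z.

Lemma connect_add_edge u v : connect e' u v = (g u == g v).
Proof.
have sub : subrel (connect e) (connect e') by exact: connect_sub.
have e'g z : connect e' z (g z).
  rewrite /g; case: ifP => [|_]; last by apply: sub; exact: connect_root.
  rewrite root_connect // => /sub zx.
  by apply: connect_trans zx (connect_trans e'xy _); apply: sub; exact: connect_root.
apply/idP/eqP => [|guv]; last first.
  by apply: connect_trans (e'g u) _; rewrite guv sym_e'.
apply: connect_preserve => {u v} u v /e'P[/(fingraph.rootP sym_e)|[]|[]].
- by rewrite /g => ->.
- by move=> /(fingraph.rootP sym_e) ux /(fingraph.rootP sym_e) vy; rewrite /g ux vy eqxx; case: eqP.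
by move=> /(fingraph.rootP sym_e) uy /(fingraph.rootP sym_e) vx; rewrite /g uy vx eqxx; case: eqP.
Qed.

(** The values of [g] are the [e]-roots except that of [x], unless [x] and [y] share their root, in
    which case [g] is the root function itself. *)
Lemma n_comp_add_edge (a : {pred T}) :
    closed e a -> closed e' a -> x \in a -> y \in a ->
  n_comp e a = (n_comp e' a + ~~ connect e x y)%N.
Proof.
move=> cl_a cl_a' ax ay; rewrite (@n_comp_kernel _ _ e' a g) //; last first.
  by move=> u v _ _; apply: connect_add_edge.
rewrite n_comp_root // -root_connect //; case: eqVneq => [rxy|nrxy].
  rewrite addn0; congr #|pred_of_set _|; apply: eq_imset => z; rewrite /g.
  by case: eqP => // ->.
have -> : g @: a = (croot e @: a) :\ croot e x.
  apply/setP => z; rewrite !inE; apply/imsetP/andP => [[u au ->]|[nz /imsetP[u au uz]]].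
    rewrite /g; case: (eqVneq (croot e u)) => [_|->]; last by rewrite imset_f.
    by rewrite eq_sym nrxy imset_f.
  by exists u => //; rewrite /g -uz (negbTE nz).
by rewrite (cardsD1 (croot e x)) imset_f // addnC.
Qed.

End AddEdge.

(** Induction, removing a pair [x], [f x] at a time. *)
Lemma involution_odd_card (T : finType) (A : {set T}) (f : T -> T) :
    {in A, forall x, [/\ f x \in A, f (f x) = x & f x != x]} -> ~~ odd #|A|.
Proof.
have [n] := ubnP #|A|; elim: n A => // n IHn A.
have [->|[x Ax]] := set_0Vmem A; first by rewrite cards0.
move=> leAn fA; have [Afx ffx nfx] := fA x Ax.
rewrite (cardsD1 x) Ax (cardsD1 (f x)) !inE nfx Afx /= negbK.
apply: IHn => [|y].
  by move: leAn; rewrite (cardsD1 x) Ax (cardsD1 (f x)) !inE nfx Afx; lia.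
rewrite !inE => /and3P[nyfx nyx Ay]; have [Afy ffy nfy] := fA y Ay.
split=> //; rewrite Afy andbT; apply/andP; split.
  by apply: contraNneq nyx => fyx; rewrite -ffx -fyx ffy.
by apply: contraNneq nyfx => <-; rewrite ffy.
Qed.

(** * Double covers of graphs and their trivializations *)

Section Cover.
Variables (T : finType) (e : rel T) (e2 : rel (T * bool)).
Hypotheses (sym_e : connect_sym e) (sym_e2 : connect_sym e2).
Hypothesis cover_proj : forall p q, e2 p q -> e p.1 q.1.
Hypothesis cover_lift : forall x y, e x y -> exists b, e2 (x, false) (y, b).
Hypothesis cover_deck : forall x y b c, e2 (x, b) (y, c) -> e2 (x, ~~ b) (y, ~~ c).

Lemma connect_cover_proj p q : connect e2 p q -> connect e p.1 q.1.
Proof.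
move=> pq; apply/(fingraph.rootP sym_e).
apply: (connect_preserve (f := fun p => croot e p.1)) pq => u v /cover_proj uv.
by apply/(fingraph.rootP sym_e); apply: connect1.
Qed.

Lemma connect_cover_deck x y b c d :
  connect e2 (x, b) (y, c) -> connect e2 (x, b (+) d) (y, c (+) d).
Proof.
case: d; rewrite ?addbF // !addbT => /connectP[p].
elim: p x b => [|[z d] p IHp] x b /= => [_ [<- <-] //|/andP[xz pz] yz].
by apply: connect_trans (connect1 (cover_deck xz)) (IHp _ _ pz yz).
Qed.

Lemma connect_cover_lift x y b :
  connect e x y -> exists c, connect e2 (x, b) (y, c).
Proof.
case/connectP=> p; elim: p x b => [|z p IHp] x b /= => [_ ->|/andP[xz pz] yz].
  by exists b.
have [c xzc] := cover_lift xz.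
have [d zd] := IHp z (c (+) b) pz yz; exists d; apply: connect_trans zd.
by have := connect_cover_deck b (connect1 xzc); rewrite addFb.
Qed.

(** Both sheets over one root per component. Every component of the cover meets [R], so there are at
    most [#|R|] of them, with equality iff the points of [R] are pairwise disconnected. *)
Let R : {set T * bool} := [set p | p.1 \in roots e].

Let cardR : #|R| = (2 * n_comp e predT)%N.
Proof.
have -> : R = setX [set x in roots e] [set: bool].
  by apply/setP => -[x b]; rewrite !inE andbT.
rewrite cardsX cardsT card_bool mulnC; congr (_ * _)%N.
by rewrite cardsE; apply: eq_card => x; rewrite !inE andbT.
Qed.

Let n_compR : n_comp e2 predT = #|croot e2 @: R|.
Proof.
rewrite n_comp_root //; apply: eq_card => p.
apply/imsetP/imsetP => -[q Rq ->]; last by exists q.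
have [c rc] := connect_cover_lift q.2 (connect_root e q.1).
exists (croot e q.1, c); first by rewrite inE /= inE roots_root.
by apply/(fingraph.rootP sym_e2); rewrite {1}[q]surjective_pairing.
Qed.

Lemma cover_n_comp_le : (n_comp e2 predT <= 2 * n_comp e predT)%N.
Proof. by rewrite -cardR n_compR leq_imset_card. Qed.

(** A trivialization of the cover: [p.2 (+) chi p.1] numbers the sheets consistently. If the counts
    agree, no path joins the two points over a root, and [chi x] can be the sheet over [x] reached
    from the root. *)
Lemma cover_n_compP :
  reflect (exists chi : T -> bool,
             forall p q, e2 p q -> p.2 (+) chi p.1 = q.2 (+) chi q.1)
          (n_comp e2 predT == 2 * n_comp e predT)%N.
Proof.
rewrite -cardR n_compR; apply: (iffP imset_injP) => [injR|[chi chiP] p q Rp Rq]; last first.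
  move=> /(fingraph.rootP sym_e2) pq.
  have := connect_preserve (f := fun p => p.2 (+) chi p.1) chiP pq.
  have := connect_cover_proj pq; rewrite -root_connect //.
  move: Rp Rq; rewrite !inE => /eqP-> /eqP-> /eqP pq1 pq2.
  case: p q pq1 pq2 {pq} => [x b] [y c] /= -> /addIb -> //.
exists (fun x => connect e2 (croot e x, false) (x, true)) => -[x b] [y c] /= xy.
have rxy : croot e x = croot e y.
  by apply/(fingraph.rootP sym_e); apply: connect1 (cover_proj xy).
have [d xd] := connect_cover_lift false (etrans (sym_e _ _) (connect_root e x)).
(* Reaching both sheets over [z] would, by the deck transformation, join the two points over the
   root. *)
have rP z f : connect e2 (croot e x, false) (z, f) ->
    connect e2 (croot e x, false) (z, true) = f.
  case: f => // zF; apply/negP => zT.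
  have : connect e2 (croot e x, true) (croot e x, false).
    have := connect_cover_deck true zT; rewrite addFb addbT /= => zT'.
    by apply: connect_trans zT' _; rewrite sym_e2.
  move=> /(fingraph.rootP sym_e2) E; have /injR := E; rewrite !inE /=.
  by rewrite !roots_root // => /(_ isT isT).
have yd : connect e2 (croot e x, false) (y, c (+) (b (+) d)).
  apply: connect_trans xd _; have := connect_cover_deck (b (+) d) (connect1 xy).
  by rewrite addKb.
by rewrite -rxy (rP _ _ xd) (rP _ _ yd); case: (b) (c) (d) => [] [] [].
Qed.

End Cover.

(** The orbits under [f] and [g] together are even cycles. The composite [h] rotates them by two
    steps, so membership in the [h]-orbit of the root is a 2-coloring. *)
Lemma involutions_bipartite (T : finType) (f g : T -> T) :
    involutive f -> involutive g -> (forall x, f x != x) -> (forall x, g x != x) ->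
  exists chi : T -> bool, forall x, chi (f x) = ~~ chi x /\ chi (g x) = ~~ chi x.
Proof.
move=> fK gK f_neq g_neq; pose e := [rel x y | (y == f x) || (y == g x)].
have sym_e : connect_sym e.
  apply: sym_connect_sym => x y /=; congr (_ || _).
    by rewrite -(inj_eq (inv_inj fK)) fK eq_sym.
  by rewrite -(inj_eq (inv_inj gK)) gK eq_sym.
pose h x := g (f x).
have inj_h : injective h by apply: inj_comp; [exact: inv_inj gK|exact: inv_inj fK].
have sym_h := fconnect_sym inj_h.
have hf x : h (f (h x)) = f x by rewrite /h fK gK.
(* If the n-th iterate of [h] sends [x] to [f x], cutting a step off at each end gives the same
   relation for [h x] and n - 2; the descent ends at a fixed point of [f] or of [g]. *)
have no_fconnect x : ~~ fconnect h x (f x).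
  apply/negP => /iter_findex; move: (findex h x (f x)) => n.
  have [m] := ubnP n; elim: m n x => // m IHm [|[|n]] x ltn hx.
  - by have /eqP := f_neq x; rewrite -hx.
  - by have /eqP := g_neq (f x); rewrite -{2}hx.
  apply: (IHm n (h x)) => [|]; first by move: ltn; lia.
  by apply: inj_h; rewrite hf -hx iterSr.
pose chi x := fconnect h (croot e x) x.
have root_fg y x : (x == f y) || (x == g y) -> croot e x = croot e y.
  by move=> yx; apply/esym/(fingraph.rootP sym_e)/connect1.
have chi_or x : chi x || chi (f x).
  rewrite /chi (@root_fg x (f x)) ?eqxx //; set r := croot e x.
  have : connect e r x by rewrite sym_e connect_root.
  (* The [h]-orbit of [r] together with its image under [f] is stable under [f] and [g], hence fills
     the component. *)
  pose S := fun x => fconnect h r x || fconnect h r (f x).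
  move=> rx; suff SrS : S r = S x by change (is_true (S x)); rewrite -SrS /S connect0.
  have S_imp u v : e u v -> S u -> S v.
    move=> /= /orP[] /eqP ->; rewrite /S ?fK; first by rewrite orbC.
    case/orP=> [ru|rfu]; apply/orP; [right|left].
      by rewrite sym_h (same_fconnect1 inj_h) /h fK gK sym_h.
    by apply: connect_trans rfu _; have := fconnect1 h (f u); rewrite {2}/h fK.
  apply: connect_preserve rx => u v uv; apply/idP/idP; first exact: S_imp uv.
  apply: S_imp; case/orP: uv => /eqP -> /=; first by rewrite fK eqxx.
  by rewrite gK eqxx orbT.
have chi_and x : ~~ (chi x && chi (f x)).
  rewrite /chi (@root_fg x (f x)) ?eqxx //; apply: contra (no_fconnect x).
  by case/andP=> rx rfx; apply: connect_trans rfx; rewrite sym_h.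
have chi_f x : chi (f x) = ~~ chi x.
  by have := chi_or x; have := chi_and x; case: (chi x); case: (chi (f x)).
exists chi => x; split=> //; apply: (canRL negbK); rewrite -chi_f /chi.
rewrite (@root_fg (g x) (f (g x))) ?(@root_fg x (g x)) ?eqxx ?orbT //.
by rewrite sym_h (same_fconnect1 inj_h) /h fK gK sym_h.
Qed.

(** * Surgery on the circles of a state *)

(** New edges join [u] to [del u] for [u] in the block, but [e] already joins each such [u] to
    [gam u]: they all have the effect of the single edge at [x]. *)
Lemma n_comp_surgery (T : finType) (e e' : rel T) (gam del : T -> T) (x : T) :
    connect_sym e -> connect_sym e' -> involutive gam -> involutive del ->
    (forall u, gam (del u) = del (gam u)) ->
    subrel e e' ->
    (forall u, u \in [:: x; gam x; del x; gam (del x)] -> e u (gam u)) ->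
    e' x (del x) ->
    (forall u v, e' u v ->
       e u v \/ u \in [:: x; gam x; del x; gam (del x)] /\ v = del u) ->
  n_comp e predT = (n_comp e' predT + ~~ connect e x (del x))%N.
Proof.
move=> sym_e sym_e' gK dK gd sub egam e'x e'P.
apply: n_comp_add_edge => //; first by move=> u v /sub/connect1.
  exact: connect1.
have exg : connect e (gam x) x.
  by rewrite sym_e connect1 // egam // mem_head.
have edg : connect e (gam (del x)) (del x).
  by rewrite sym_e connect1 // egam // !inE eqxx !orbT.
move=> u v /e'P[/connect1|[+ ->]]; first by constructor.
rewrite !inE => /or4P[] /eqP ->.
- by constructor 2.
- by constructor 2; rewrite -gd.
- by constructor 3; rewrite dK.
by constructor 3; rewrite -gd dK.
Qed.

(* T is the set of half-arcs of the crossings in C, matched by alpha; b0 and b1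
   are the two smoothings.  A set H of crossings is read as the subgraph with
   these edges of the graph whose vertices are the circles obtained by
   smoothing every crossing with b0. *)
Section Surgery.
Variables (T C : finType) (p : T -> C) (alpha b0 b1 : T -> T).
Hypotheses (alphaK : involutive alpha) (b0K : involutive b0) (b1K : involutive b1).
Hypotheses (alpha_neq : forall x, alpha x != x) (b0_neq : forall x, b0 x != x)
  (b1_neq : forall x, b1 x != x).
Hypotheses (p_b0 : forall x, p (b0 x) = p x) (p_b1 : forall x, p (b1 x) = p x).
Hypothesis b01C : forall x, b0 (b1 x) = b1 (b0 x).
Hypothesis p_surj : forall c, exists x, p x = c.
Hypothesis p_block : forall x y, p x = p y -> y \in [:: x; b0 x; b1 x; b0 (b1 x)].
Implicit Types (x y : T) (c : C) (H : {set C}).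

Definition smoothed H x := if p x \in H then b1 x else b0 x.
Definition circle_rel H : rel T := [rel x y | (y == alpha x) || (y == smoothed H x)].
Definition subgraph_rel H : rel T :=
  [rel x y | [|| y == alpha x, y == b0 x | (p x \in H) && (y == b1 x)]].

Lemma smoothedK H : involutive (smoothed H).
Proof.
by move=> x; rewrite /smoothed; case xH: (p x \in H); rewrite ?(p_b0, p_b1) xH.
Qed.

Lemma smoothed_neq H x : smoothed H x != x.
Proof. by rewrite /smoothed; case: ifP. Qed.

Lemma circle_rel_sym H : connect_sym (circle_rel H).
Proof.
apply: sym_connect_sym => x y; rewrite /circle_rel /subgraph_rel /=; congr (_ || _).
  by rewrite -(inj_eq (inv_inj alphaK)) alphaK eq_sym.
by rewrite -(inj_eq (inv_inj (smoothedK H))) smoothedK eq_sym.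
Qed.

Lemma subgraph_rel_sym H : connect_sym (subgraph_rel H).
Proof.
apply: sym_connect_sym => x y; rewrite /circle_rel /subgraph_rel /=; congr [|| _, _ | _].
- by rewrite -(inj_eq (inv_inj alphaK)) alphaK eq_sym.
- by rewrite -(inj_eq (inv_inj b0K)) b0K eq_sym.
rewrite -(inj_eq (inv_inj b1K)) b1K eq_sym.
by case: eqP => [->|]; rewrite ?p_b1 ?andbF.
Qed.

Lemma subgraph_circle0 : n_comp (subgraph_rel set0) predT = n_comp (circle_rel set0) predT.
Proof.
by apply: eq_n_comp; apply: eq_connect => x y; rewrite /circle_rel /subgraph_rel /= /smoothed !in_set0 orbF.
Qed.

(* The ends of the arcs cut out by removing the crossing p x match in pairs: if
   those at x and b1 x are on distinct circles, the arc from x leads to b0 x. *)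
Lemma connect_other_smoothing H x : p x \notin H ->
  ~~ connect (circle_rel H) x (b1 x) -> connect (circle_rel (p x |: H)) x (b0 x).
Proof.
move=> xH nb1; apply: contraT => nb0.
pose M : rel T := [rel u v | (v == alpha u) || (p u != p x) && (v == smoothed H u)].
have M0 : subrel (connect M) (connect (circle_rel H)).
  apply: connect_sub => u v /orP[/eqP->|/andP[_ /eqP->]]; apply: connect1; rewrite /circle_rel /subgraph_rel /=;
  by rewrite eqxx ?orbT.
have M1 : subrel (connect M) (connect (circle_rel (p x |: H))).
  apply: connect_sub => u v /orP[/eqP->|/andP[ux /eqP->]]; apply: connect1; rewrite /circle_rel /subgraph_rel /=;
  by rewrite /smoothed ?inE ?(negbTE ux) eqxx ?orbT.
pose K := [set y | connect M x y].
have Kblock y : y \in K -> p y = p x -> y = x.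
  rewrite in_set => xy /esym /p_block; rewrite !inE => /or4P[] /eqP yE //;
    move: xy; rewrite yE => xy.
  - by rewrite (M1 _ _ xy) in nb0.
  - by rewrite (M0 _ _ xy) in nb1.
  have : connect (circle_rel H) x (b1 x).
    apply: connect_trans (M0 _ _ xy) (connect1 _).
    by rewrite /circle_rel /subgraph_rel /= /smoothed p_b0 p_b1 (negbTE xH) b0K eqxx orbT.
  by rewrite (negbTE nb1).
have Kx : x \in K by rewrite in_set connect0.
have Kstep y z : y \in K -> M y z -> z \in K.
  move=> Ky yz; have xy : connect M x y by move: Ky; rewrite in_set.
  by rewrite in_set; apply: connect_trans xy (connect1 yz).
have K_even : ~~ odd #|K|.
  apply: (involution_odd_card (f := alpha)) => y Ky; split=> //.
  by apply: Kstep Ky _; rewrite /M /circle_rel /subgraph_rel /= eqxx.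
have Kx_even : ~~ odd #|K :\ x|.
  apply: (involution_odd_card (f := smoothed H)) => y; rewrite !inE => /andP[nyx Ky].
  rewrite smoothedK smoothed_neq; split=> //.
  have pyx : p y != p x by apply: contraNneq nyx => pyx; rewrite (Kblock y) ?inE.
  have -> : smoothed H y != x.
    by apply: contraNneq pyx => <-; rewrite /smoothed; case: ifP; rewrite ?p_b0 ?p_b1.
  have /(Kstep y) : y \in K by rewrite inE.
  by move=> /(_ (smoothed H y)); rewrite inE; apply; rewrite /M /circle_rel /subgraph_rel /= pyx eqxx orbT.
by move: K_even; rewrite (cardsD1 x) Kx /= (negbTE Kx_even).
Qed.

Lemma b1_block x y : y \in [:: x; b0 x; b1 x; b0 (b1 x)] -> p y = p x.
Proof. by rewrite !inE => /or4P[] /eqP->; rewrite ?(p_b0, p_b1). Qed.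

(** Both states are compared with their union [Q]. By [connect_other_smoothing], at most one of them
    has its two strands at the crossing on distinct circles, so the circle counts differ by at most
    one. If the new edge joins two pieces of [H], the strands of [H] are on distinct circles, which
    get merged. *)
Lemma euler_step H c : c \notin H ->
  (2 * n_comp (subgraph_rel H) predT + n_comp (circle_rel (c |: H)) predT
   <= 2 * n_comp (subgraph_rel (c |: H)) predT + 1 + n_comp (circle_rel H) predT)%N.
Proof.
have [x <-] := p_surj c => xH.
pose Q : rel T := [rel u v | circle_rel H u v || circle_rel (p x |: H) u v].
have sym_Q : connect_sym Q by apply: relU_sym; exact: circle_rel_sym.
have subgraphE : n_comp (subgraph_rel H) predT
    = (n_comp (subgraph_rel (p x |: H)) predT + ~~ connect (subgraph_rel H) x (b1 x))%N.
  apply: (@n_comp_surgery _ _ _ b0) => //; try exact: subgraph_rel_sym.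
  - by move=> u v; rewrite /circle_rel /subgraph_rel /= => /or3P[->|->|/andP[uH ->]] //; rewrite ?orbT // inE uH !orbT.
  - by move=> u _; rewrite /circle_rel /subgraph_rel /= eqxx orbT.
  - by rewrite /circle_rel /subgraph_rel /= !inE !eqxx !orbT.
  move=> u v; rewrite /circle_rel /subgraph_rel /= => /or3P[->|->|]; rewrite ?orbT; [by left|by left|].
  rewrite !inE => /andP[/orP[/eqP ux|uH] /eqP ->]; last by left; rewrite uH eqxx !orbT.
  by right; split=> //; have := p_block (esym ux); rewrite !inE.
have circle0E : n_comp (circle_rel H) predT
    = (n_comp Q predT + ~~ connect (circle_rel H) x (b1 x))%N.
  apply: (@n_comp_surgery _ _ _ b0) => //; first exact: circle_rel_sym.
  - by move=> u v uv; rewrite /Q /= uv.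
  - by move=> u /b1_block ux; rewrite /Q /circle_rel /subgraph_rel /= /smoothed ux (negbTE xH) eqxx orbT.
  - by rewrite /Q /circle_rel /subgraph_rel /= /smoothed !inE !eqxx !orbT.
  move=> u v; rewrite /Q /circle_rel /subgraph_rel /= => /orP[|/orP[->|]]; [by left|by left|]; rewrite /smoothed !inE.
  have [ux|] := eqVneq (p u) (p x); last by left; rewrite b orbT.
  by move=> /eqP->; right; split=> //; have := p_block (esym ux); rewrite !inE.
have circle1E : n_comp (circle_rel (p x |: H)) predT
    = (n_comp Q predT + ~~ connect (circle_rel (p x |: H)) x (b0 x))%N.
  apply: (@n_comp_surgery _ _ _ b1) => //; first exact: circle_rel_sym.
  - by move=> u v uv; rewrite /Q /= uv orbT.
  - move=> u ux; have {}ux : p u = p x.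
      by apply: b1_block; move: ux; rewrite !inE b01C => /or4P[] ->; rewrite ?orbT.
    by rewrite /Q /circle_rel /subgraph_rel /= /smoothed !inE ux !eqxx orbT.
  - by rewrite /Q /circle_rel /subgraph_rel /= /smoothed (negbTE xH) !eqxx !orbT.
  move=> u v; rewrite /Q /circle_rel /subgraph_rel /= => /orP[/orP[->|]|]; [by left| |by left]; rewrite /smoothed !inE.
  have [ux|] := eqVneq (p u) (p x); last by left; rewrite b orbT.
  rewrite ux (negbTE xH) => /eqP->; right; split=> //.
  by have := p_block (esym ux); rewrite !inE b01C => /or4P[] ->; rewrite ?orbT.
have sub0 : connect (circle_rel H) x (b1 x) -> connect (subgraph_rel H) x (b1 x).
  apply: connect_sub => u v /= /orP[/eqP->|/eqP->]; apply: connect1.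
    by rewrite /circle_rel /subgraph_rel /= eqxx.
  by rewrite /smoothed /circle_rel /subgraph_rel /=; case: ifP; rewrite eqxx !orbT.
have := @connect_other_smoothing H x xH; move: sub0.
rewrite subgraphE circle0E circle1E.
case: (connect (circle_rel H) _ _) => [/(_ isT) ->|_ /(_ isT) ->] /=.
  by case: connect; lia.
by case: (connect (subgraph_rel H) _ _) => /=; lia.
Qed.

(** Iterates [euler_step] over the crossings of [H' :\: H]: twice the pieces, plus the crossings,
    minus the circles never decreases. The additive form avoids truncated subtraction. *)
Lemma euler_monotone H H' : H \subset H' ->
  (2 * n_comp (subgraph_rel H) predT + #|H| + n_comp (circle_rel H') predT
   <= 2 * n_comp (subgraph_rel H') predT + #|H'| + n_comp (circle_rel H) predT)%N.
Proof.
have [n] := ubnP #|H' :\: H|; elim: n H => // n IHn H ltn sHH'.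
have [E|[c]] := set_0Vmem (H' :\: H).
  have -> : H' = H; last by [].
  by apply/eqP; rewrite eqEsubset sHH' andbT -setD_eq0 E.
rewrite inE => /andP[cH cH']; have := euler_step cH.
have : (#|H' :\: (c |: H)| < n)%N.
  apply: leq_trans (_ : #|H' :\: H| <= _)%N; last by rewrite -ltnS.
  apply: proper_card; apply/properP; split; first by apply: setDS; exact: subsetUr.
  by exists c; rewrite !inE ?cH ?cH' ?eqxx.
move=> /IHn; rewrite subUset sub1set cH' sHH' => /(_ isT).
by rewrite cardsU1 cH; lia.
Qed.

End Surgery.

(** * Balanced subgraphs and the myopic Tutte polynomial *)

Section GraphRP2.
Variables V E : finType.
Implicit Types (G : graphRP2 V E) (e f : E) (H S : {set E}).

Definition restrict G H : graphRP2 V E :=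
  GraphRP2 (vertices G) H (src G) (tgt G) (odd_edge G).
Definition reach G H : rel V := connect (adjacent (restrict G H)).
Definition components G H : nat :=
  n_comp (adjacent (restrict G H)) (mem (vertices G)).

(* All cycles of H vanish in H_1(RP^2). *)
Definition balanced G H : bool :=
  [exists chi : {ffun V -> bool},
    [forall e in H, chi (src G e) (+) chi (tgt G e) == odd_edge G e]].

Definition ends_in_vertices G H : Prop :=
  {in H, forall e, src G e \in vertices G /\ tgt G e \in vertices G}.

Lemma balancedP G H :
  reflect (exists chi : V -> bool, {in H, forall e,
             chi (src G e) (+) chi (tgt G e) = odd_edge G e})
          (balanced G H).
Proof.
apply: (iffP existsP) => -[chi chiP]; last first.
  by exists (finfun chi); apply/forall_inP => e eH; rewrite !ffunE chiP.
by exists chi => e eH; apply/eqP/(forall_inP chiP).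
Qed.

Lemma adjacentP G H u v :
  reflect (exists2 e, e \in H & (src G e = u /\ tgt G e = v) \/ (src G e = v /\ tgt G e = u))
          (adjacent (restrict G H) u v).
Proof.
apply: (iffP exists_inP) => -[e eH uv]; exists e => //.
  by case/orP: uv => /andP[/eqP-> /eqP->]; [left|right].
by rewrite /=; case: uv => -[-> ->]; rewrite !eqxx ?orbT.
Qed.

Lemma reach_sym G H : connect_sym (adjacent (restrict G H)).
Proof.
apply: sym_connect_sym => u v.
by apply/adjacentP/adjacentP => -[e eH uv]; exists e => //; case: uv; [right|left|right|left].
Qed.

Lemma reach_edge G H e : e \in H -> reach G H (src G e) (tgt G e).
Proof. by move=> eH; apply: connect1; apply/adjacentP; exists e => //; left. Qed.

Lemma reach_sub G H H' : H \subset H' -> subrel (reach G H) (reach G H').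
Proof.
move=> sHH'; apply: connect_sub => u v /adjacentP[e eH uv]; apply: connect1.
by apply/adjacentP; exists e => //; apply: (subsetP sHH').
Qed.

Lemma adjacent_closed G H :
  ends_in_vertices G H -> closed (adjacent (restrict G H)) (mem (vertices G)).
Proof. by move=> wf u v /adjacentP[e /wf[su tu] [[<- <-]|[<- <-]]]; rewrite su tu. Qed.

Lemma components_setU1 G H e : ends_in_vertices G (e |: H) ->
  components G H
  = (components G (e |: H) + ~~ reach G H (src G e) (tgt G e))%N.
Proof.
move=> wf; have [se te] := wf e (setU11 _ _).
apply: n_comp_add_edge => //; try exact: reach_sym.
- by move=> u v uv; apply: (reach_sub (subsetUr _ _)); apply: connect1.
- exact: reach_edge (setU11 _ _).
- move=> u v /adjacentP[f]; rewrite !inE => /orP[/eqP->|fH] uv.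
    by case: uv => -[-> ->]; [constructor 2|constructor 3].
  by constructor; apply: connect1; apply/adjacentP; exists f.
- by apply: adjacent_closed => f fH; apply: wf; rewrite inE fH orbT.
exact: adjacent_closed.
Qed.

Section Contract.
Variables (G : graphRP2 V E) (H : {set E}) (e : E).
Hypotheses (wf : ends_in_vertices G (e |: H)) (e_loop : ~~ is_loop G e).

Let e_neq : src G e != tgt G e := e_loop.
Let merge v := if v == tgt G e then src G e else v.

Lemma reach_contract u v :
  reach G (e |: H) u v = reach (contract G e) H (merge u) (merge v).
Proof.
have e_edge := reach_edge G (setU11 e H).
have sym := reach_sym G (e |: H).
have mergeP w : reach G (e |: H) w (merge w).
  rewrite /merge; case: eqP => [->|_]; last exact: connect0.
  by rewrite /reach sym.
apply/idP/idP => [|uv].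
  move=> uv; apply/(fingraph.rootP (reach_sym (contract G e) H)).
  apply: (connect_preserve (f := fun w => croot (adjacent (restrict (contract G e) H)) (merge w))) uv.
  move=> {u v} u v /adjacentP[f fH uv].
  apply/(fingraph.rootP (reach_sym (contract G e) H)).
  move: fH; rewrite !inE => /orP[/eqP fe|fH].
    have st : merge (src G e) = merge (tgt G e).
      by rewrite /merge eqxx (negbTE e_neq).
    by case: uv; rewrite fe => -[<- <-]; rewrite st.
  apply: connect1; apply/adjacentP; exists f => //.
  by case: uv => -[<- <-]; [left|right].
apply: connect_trans (mergeP u) _; rewrite sym; apply: connect_trans (mergeP v) _.
rewrite sym; apply: (connect_sub _ uv) => x y /adjacentP[f fH] xy.
have fE : reach G (e |: H) (merge (src G f)) (merge (tgt G f)).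
  apply: connect_trans (mergeP (tgt G f)); rewrite sym.
  apply: connect_trans (mergeP (src G f)); rewrite sym.
  by apply: reach_edge; rewrite inE fH orbT.
by case: xy => -[/= <- <-] //; rewrite sym.
Qed.

Lemma components_contract : components (contract G e) H = components G (e |: H).
Proof.
have [se te] := wf (setU11 _ _).
have sV w : w \in vertices G -> merge w \in vertices G :\ tgt G e.
  by rewrite /merge !inE; case: ifP => [_ _|-> ->] //; rewrite e_neq se.
have wf' : ends_in_vertices (contract G e) H.
  by move=> f fH; have [] := wf (setU1r e fH); split; apply: sV.
rewrite /components n_comp_root; [|exact: reach_sym|exact: adjacent_closed].
rewrite (@n_comp_kernel _ _ (adjacent (restrict G (e |: H))) _
  (fun w => croot (adjacent (restrict (contract G e) H)) (merge w))).
- apply: eq_card => z; apply/imsetP/imsetP => -[w wV ->]; last first.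
    by exists (merge w) => //; apply: sV.
  move: wV; rewrite !inE => /andP[wt wV]; exists w => //.
  by rewrite /merge (negbTE wt).
- exact: reach_sym.
- exact: adjacent_closed.
by move=> u v _ _; rewrite root_connect; [exact: reach_contract|exact: reach_sym].
Qed.

(** On [e |: H], the value of a potential at [tgt G e] is forced by its value at [src G e]; the
    parity change made by [contract] is exactly this correction. *)
Lemma balanced_contract : e \notin H -> balanced (contract G e) H = balanced G (e |: H).
Proof.
move=> eH; apply/balancedP/balancedP => -[chi chiP].
  exists (fun v => if v == tgt G e then chi (src G e) (+) odd_edge G e else chi v).
  move=> f; rewrite !inE => /orP[/eqP->|/chiP /=].
    by rewrite eqxx (negbTE e_neq) addKb.
  rewrite /merge; case: eqP => _; case: eqP => _ /=;
    case: (odd_edge G f); case: (odd_edge G e); case: (chi (src G e));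
    by case: (chi (src G f)); case: (chi (tgt G f)).
exists chi => f fH; rewrite /= -(chiP f) ?inE ?fH ?orbT // -(chiP e) ?setU11 //.
by case: eqP => [->|_]; case: eqP => [->|_] /=;
  case: (chi (src G e)); case: (chi (tgt G e)); case: (chi (src G f)); case: (chi (tgt G f)).
Qed.

End Contract.

Lemma balanced_sub G H H' : H \subset H' -> balanced G H' -> balanced G H.
Proof.
move=> sHH' /balancedP[chi chiP]; apply/balancedP; exists chi => e eH.
by apply: chiP; apply: (subsetP sHH').
Qed.

(** Adding the defect [s] of the equation on [e] to a potential, on the whole [H]-component of
    [src G e], keeps the equations on [H] and repairs the one on [e]. *)
Lemma balanced_bridge G H e :
  ~~ reach G H (src G e) (tgt G e) -> balanced G (e |: H) = balanced G H.
Proof.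
move=> br; apply/idP/idP; first exact: balanced_sub (subsetUr _ _).
move=> /balancedP[chi chiP]; apply/balancedP.
pose s := chi (src G e) (+) chi (tgt G e) (+) odd_edge G e.
exists (fun v => chi v (+) (s && reach G H (src G e) v)) => f.
have src_f : f \in H -> reach G H (src G e) (src G f) = reach G H (src G e) (tgt G f).
  by move=> fH; apply: (same_connect_r (reach_sym G H)); apply: reach_edge.
rewrite !inE => /orP[/eqP->|fH].
  rewrite (negbTE br) /reach connect0 /s.
  by case: (chi (src G e)); case: (chi (tgt G e)); case: (odd_edge G e).
rewrite -(chiP f) // src_f //.
by case: (chi _); case: (chi _); case: (s && _).
Qed.

Lemma balanced_even_loop G H e : is_loop G e -> ~~ odd_edge G e ->
  balanced G (e |: H) = balanced G H.
Proof.
move=> /eqP le oe; apply/idP/idP; first exact: balanced_sub (subsetUr _ _).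
move=> /balancedP[chi chiP]; apply/balancedP; exists chi => f.
by rewrite !inE => /orP[/eqP->|/chiP //]; rewrite le addbb (negbTE oe).
Qed.

Lemma balanced_odd_loop G H e : is_loop G e -> odd_edge G e ->
  ~~ balanced G (e |: H).
Proof.
move=> /eqP le oe; apply/balancedP => -[chi /(_ e (setU11 _ _))].
by rewrite le addbb oe.
Qed.

Lemma components_edgeless G : components G set0 = #|vertices G|.
Proof.
have no_edge u v : adjacent (restrict G set0) u v = false.
  by apply/adjacentP => -[e]; rewrite inE.
rewrite /components (@n_comp_kernel _ _ _ _ id).
- by rewrite imset_id.
- exact: reach_sym.
- by move=> u v; rewrite no_edge.
move=> u v _ _; apply/idP/eqP => [|->]; last exact: connect0.
by apply: connect_preserve => x y; rewrite no_edge.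
Qed.

End GraphRP2.

Lemma sum_subsetsD1 (E : finType) (R : nmodType) (S : {set E}) (e : E)
    (F : {set E} -> R) : e \in S ->
  \sum_(H : {set E} | H \subset S) F H
  = \sum_(H : {set E} | H \subset S :\ e) (F H + F (e |: H)).
Proof.
move=> eS; rewrite big_split /= (bigID (fun H : {set E} => e \notin H)) /=.
congr (_ + _); first by apply: eq_bigl => H; rewrite subsetD1.
rewrite (reindex_onto (fun H => e |: H) (fun H => H :\ e)) /=; last first.
  by move=> H /andP[_]; rewrite negbK => /setD1K.
apply: eq_bigl => H; rewrite setU11 andbT subsetD1 subUset sub1set eS /=.
congr (_ && _); apply/eqP/idP => [<-|]; first by rewrite !inE eqxx.
by move/setU1K.
Qed.

(** * The weighted sum over balanced subgraphs and its deletion-contraction recursion *)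

Section StateSum.
Variables (V E : finType) (K : fieldType) (A : K).
Implicit Types (G : graphRP2 V E) (e f : E) (H : {set E}).
Let loop : K := - A ^+ 2 - A ^- 2.
Hypotheses (A_neq0 : A != 0) (loop_neq0 : loop != 0).

(** Only graph quantities occur, so that the sum also makes sense for minors. For the Tait graphs
    below, the exponent of [loop] is the number of circles of the state minus one. *)
Definition state_term G H : K :=
  if balanced G H then
    A ^ (2 * #|H|%:Z - #|edges G|%:Z)
    * loop ^ (2 * (components G H)%:Z + #|H|%:Z - #|vertices G|%:Z - 1)
  else 0.

Definition state_sum G : K := \sum_(H : {set E} | H \subset edges G) state_term G H.

Let card_edges G e : e \in edges G -> #|edges G|%:Z = #|edges G :\ e|%:Z + 1.
Proof. by move=> eG; rewrite (cardsD1 e) eG; lia. Qed.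

Lemma state_term_delete G H e : e \in edges G ->
  state_term G H = A^-1 * state_term (delete G e) H.
Proof.
move=> eG; rewrite /state_term (card_edges eG) /=.
rewrite -[balanced (delete _ _) _]/(balanced G H) -[components (delete _ _) _]/(components G H).
case: ifP => _; rewrite ?mulr0 // mulrA; congr (_ * _).
by rewrite -[A^-1]exprN1 -expfzDr //; congr (_ ^ _); ring.
Qed.

Lemma state_term_even_loop G H e : e \in edges G -> e \notin H ->
    ends_in_vertices G (e |: H) -> is_loop G e -> ~~ odd_edge G e ->
  state_term G (e |: H) = A * loop * state_term (delete G e) H.
Proof.
move=> eG eH wf le oe; rewrite /state_term (card_edges eG) /=.
rewrite balanced_even_loop // -[balanced (delete _ _) _]/(balanced G H).
rewrite -[components (delete _ _) _]/(components G H).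
rewrite (components_setU1 wf) (eqP le) /reach connect0 addn0 cardsU1 eH.
case: ifP => _; rewrite ?mulr0 // mulrACA -{2}[A]expr1z -{2}[loop]expr1z -!expfzDr //.
by congr (_ ^ _ * _ ^ _); lia.
Qed.

Lemma state_term_odd_loop G H e : is_loop G e -> odd_edge G e ->
  state_term G (e |: H) = 0.
Proof. by move=> le oe; rewrite /state_term (negbTE (balanced_odd_loop _ _ _)). Qed.

Section NonLoop.
Variables (G : graphRP2 V E) (e : E) (H : {set E}).
Hypotheses (eG : e \in edges G) (eH : e \notin H).
Hypotheses (wf : ends_in_vertices G (e |: H)) (e_loop : ~~ is_loop G e).

Let card_vertices : #|vertices G|%:Z = #|vertices G :\ tgt G e|%:Z + 1.
Proof. by have [_ tV] := wf (setU11 _ _); rewrite (cardsD1 (tgt G e)) tV; lia. Qed.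

Lemma state_term_contract : state_term G (e |: H) = A * state_term (contract G e) H.
Proof.
rewrite /state_term (card_edges eG) card_vertices /=.
rewrite balanced_contract // components_contract // cardsU1 eH.
case: ifP => _; rewrite ?mulr0 // mulrA -{2}[A]expr1z -!expfzDr //.
by congr (_ ^ _ * _ ^ _); lia.
Qed.

(** Passing to the contraction lowers the number of components of [H] and the number of vertices by
    one each, whence 2 - 1 = 1 factor [loop]. *)
Lemma state_term_bridge : ~~ reach G H (src G e) (tgt G e) ->
  state_term G H = A^-1 * loop * state_term (contract G e) H.
Proof.
move=> br; rewrite /state_term (card_edges eG) card_vertices /=.
rewrite balanced_contract // components_contract // balanced_bridge //.
rewrite (components_setU1 wf) br.
case: ifP => _; rewrite ?mulr0 // mulrACA -[A^-1]exprN1 -{2}[loop]expr1z -!expfzDr //.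
by congr (_ ^ _ * _ ^ _); lia.
Qed.

End NonLoop.

Lemma eval2D (p q : {poly {poly int}}) (x y : K) :
  eval2 (p + q) x y = eval2 p x y + eval2 q x y.
Proof. by rewrite /eval2 !(rmorphD, hornerD). Qed.

Lemma eval2M (p q : {poly {poly int}}) (x y : K) :
  eval2 (p * q) x y = eval2 p x y * eval2 q x y.
Proof. by rewrite /eval2 !(rmorphM, hornerM). Qed.

Lemma eval2_1 (x y : K) : eval2 1 x y = 1.
Proof. by rewrite /eval2 !(rmorph1, hornerC). Qed.

Lemma eval2_X (x y : K) : eval2 'X x y = x.
Proof. by rewrite /eval2 map_polyX hornerX hornerC. Qed.

Lemma eval2_Y (x y : K) : eval2 'Y x y = y.
Proof. by rewrite /eval2 map_polyC /= map_polyX hornerC hornerX. Qed.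

Section Recursion.
Variables (G : graphRP2 V E) (e : E).
Hypotheses (eG : e \in edges G) (wf : ends_in_vertices G (edges G)).

Let sub_wf H : H \subset edges G :\ e -> e \notin H /\ ends_in_vertices G (e |: H).
Proof.
rewrite subsetD1 => /andP[sH eH]; split=> // f; rewrite !inE => /orP[/eqP->|fH].
  exact: wf.
by apply: wf; apply: (subsetP sH).
Qed.

Lemma state_sum_ordinary : ~~ is_loop G e ->
  state_sum G = A^-1 * state_sum (delete G e) + A * state_sum (contract G e).
Proof.
move=> le; rewrite /state_sum (sum_subsetsD1 _ eG) !mulr_sumr -big_split.
apply: eq_bigr => H /sub_wf[eH wfeH] /=.
by rewrite (state_term_delete _ eG) (state_term_contract eG).
Qed.

Lemma state_sum_bridge : is_bridge G e -> ~~ is_loop G e ->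
  state_sum G = (A^-1 * loop + A) * state_sum (contract G e).
Proof.
move=> br le; rewrite /state_sum (sum_subsetsD1 _ eG) !mulr_sumr.
apply: eq_bigr => H sH /=; have [eH wfeH] := sub_wf sH.
rewrite (state_term_bridge eG) ?(state_term_contract eG) ?mulrDl //.
by apply: contra br; apply: reach_sub.
Qed.

Lemma state_sum_even_loop : is_loop G e -> ~~ odd_edge G e ->
  state_sum G = (A^-1 + A * loop) * state_sum (delete G e).
Proof.
move=> le oe; rewrite /state_sum (sum_subsetsD1 _ eG) !mulr_sumr.
apply: eq_bigr => H /sub_wf[eH wfeH] /=.
by rewrite (state_term_delete _ eG) state_term_even_loop // mulrDl.
Qed.

(** The subgraphs containing [e] are unbalanced and drop out, in accordance with the myopic rule for
    essential loops. *)
Lemma state_sum_odd_loop : is_loop G e -> odd_edge G e ->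
  state_sum G = A^-1 * state_sum (delete G e).
Proof.
move=> le oe; rewrite /state_sum (sum_subsetsD1 _ eG) !mulr_sumr.
apply: eq_bigr => H _ /=.
by rewrite (state_term_delete _ eG) state_term_odd_loop // addr0.
Qed.

Lemma components_delete_edge : ~~ is_bridge G e ->
  components (delete G e) (edges (delete G e)) = components G (edges G).
Proof.
move=> /negbNE br; have [_ wfE] := sub_wf (subxx _).
rewrite -[LHS]/(components G (edges G :\ e)) (components_setU1 wfE).
by rewrite setD1K // [reach _ _ _ _]br addn0.
Qed.

Lemma components_contract_edge : ~~ is_loop G e ->
  components (contract G e) (edges (contract G e)) = components G (edges G).
Proof.
move=> le; have [_ wfE] := sub_wf (subxx _).
by rewrite [LHS](components_contract wfE) // setD1K.
Qed.

Lemma ends_in_vertices_delete : ends_in_vertices (delete G e) (edges (delete G e)).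
Proof. by move=> f; rewrite inE => /andP[_ /wf]. Qed.

Lemma ends_in_vertices_contract : ~~ is_loop G e ->
  ends_in_vertices (contract G e) (edges (contract G e)).
Proof.
move=> le f; rewrite inE => /andP[_ /wf[sf tf]]; have [se te] := wf eG.
by rewrite /= !inE; split; case: ifP => [_|-> //]; rewrite se andbT; exact: le.
Qed.

Lemma card_vertices_contract : #|vertices G|%:Z = #|vertices G :\ tgt G e|%:Z + 1.
Proof. by have [_ tV] := wf eG; rewrite (cardsD1 (tgt G e)) tV; lia. Qed.

End Recursion.

(** The prefactor normalizes the recursion. With V vertices and E edges, 2V - E grows by 1 under
    deletion and drops by 1 under contraction, compensating the factors A^-1 and A; the number of
    components stays fixed. A bridge gives A^-1 loop + A = A (- A^-4) and an even loop gives A^-1 +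
    A loop = A^-1 (- A^4), whence the values of x and y. *)
Lemma state_sum_myopic_tutte G p : ends_in_vertices G (edges G) -> myopic_tutte G p ->
  state_sum G
  = A ^ (2 * #|vertices G|%:Z - #|edges G|%:Z - 2 * (components G (edges G))%:Z)
    * loop ^ ((components G (edges G))%:Z - 1) * eval2 p (- A ^- 4) (- A ^+ 4).
Proof.
have expD1 a : A ^ (a + 1) = A ^ a * A by rewrite expfzDr // expr1z.
have expB1 a : A ^ (a - 1) = A ^ a / A by rewrite expfzDr // exprN1.
move=> + GP; elim: GP => {G p}.
- move=> G G0 _; rewrite /state_sum G0 (big_pred1 set0) => [|H]; last by rewrite subset0.
  rewrite /state_term G0 !cards0 components_edgeless eval2_1 mulr1.
  have -> : balanced G set0 by apply/balancedP; exists xpred0 => e; rewrite inE.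
  by congr (_ ^ _ * _ ^ _); lia.
- move=> G e p q eG br le _ IHp _ IHq wf; rewrite (state_sum_ordinary eG wf le).
  rewrite IHp ?IHq; [|exact: ends_in_vertices_contract|exact: ends_in_vertices_delete].
  rewrite components_delete_edge ?components_contract_edge // (card_edges eG) /=.
  rewrite eval2D mulrDr (card_vertices_contract eG wf).
  set v : int := #|_ :\ tgt G e|%:Z; set m : int := #|_ :\ e|%:Z.
  set k : int := (components _ _)%:Z.
  have -> : 2 * (v + 1) - (m + 1) - 2 * k = 2 * (v + 1) - m - 2 * k + (- 1) by ring.
  rewrite expB1; congr (_ + _); first by ring.
  have -> : 2 * (v + 1) - m - 2 * k = 2 * v - m - 2 * k + 1 + 1 by ring.
  by rewrite !expD1; field.
- move=> G e p eG br _ IHp wf; have le : ~~ is_loop G e.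
    by apply: contra br => /eqP->; exact: connect0.
  rewrite (state_sum_bridge eG wf br le) IHp; last exact: ends_in_vertices_contract.
  rewrite components_contract_edge // (card_edges eG) /=.
  rewrite eval2M eval2_X (card_vertices_contract eG wf).
  have -> : A^-1 * loop + A = A * (- A ^- 4) by rewrite /loop; field.
  set v : int := #|_ :\ tgt G e|%:Z; set m : int := #|_ :\ e|%:Z.
  set k : int := (components _ _)%:Z.
  have -> : 2 * (v + 1) - (m + 1) - 2 * k = 2 * v - m - 2 * k + 1 by ring.
  by rewrite expD1; ring.
- move=> G e p eG le oe _ IHp wf; have br : ~~ is_bridge G e.
    by rewrite negbK (eqP le) connect0.
  rewrite (state_sum_even_loop eG wf le oe) IHp; last exact: ends_in_vertices_delete.
  rewrite components_delete_edge // (card_edges eG) /= eval2M eval2_Y.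
  have -> : A^-1 + A * loop = A^-1 * (- A ^+ 4) by rewrite /loop; field.
  set v : int := #|_|%:Z; set m : int := #|_ :\ e|%:Z.
  set k : int := (components _ _)%:Z.
  have -> : 2 * v - (m + 1) - 2 * k = 2 * v - m - 2 * k - 1 by ring.
  by rewrite expB1; ring.
move=> G e p eG le oe _ IHp wf; have br : ~~ is_bridge G e.
  by rewrite negbK (eqP le) connect0.
rewrite (state_sum_odd_loop eG le oe) IHp; last exact: ends_in_vertices_delete.
rewrite components_delete_edge // (card_edges eG) /=.
set v : int := #|_|%:Z; set m : int := #|_ :\ e|%:Z.
set k : int := (components _ _)%:Z.
have -> : 2 * v - (m + 1) - 2 * k = 2 * v - m - 2 * k - 1 by ring.
by rewrite expB1; ring.
Qed.

End StateSum.

(** * States of a diagram and their lifts to the double cover *)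

Section Darts.
Variable D : pd_code.
Implicit Types d k : dart D.

Lemma is_over_ccw d : is_over (ccw d) = ~~ is_over d.
Proof. by case: d => c [[|[|[|[|i]]]] //= lti]. Qed.

Lemma is_over_cw d : is_over (cw d) = ~~ is_over d.
Proof. by case: d => c [[|[|[|[|i]]]] //= lti]. Qed.

Lemma ccwK : cancel (@ccw D) (@cw D).
Proof. by case=> c i; rewrite /cw /ccw /= addrK. Qed.

Lemma cwK : cancel (@cw D) (@ccw D).
Proof. by case=> c i; rewrite /cw /ccw /= subrK. Qed.

Lemma cw_neq d : cw d != d.
Proof. by apply/eqP => /(congr1 (@is_over D)); rewrite is_over_cw; case: is_over. Qed.

Lemma ccw_neq d : ccw d != d.
Proof. by apply/eqP => /(congr1 (@is_over D)); rewrite is_over_ccw; case: is_over. Qed.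

Lemma cw2_opposite d : cw (cw d) = opposite d.
Proof. by case: d => c [[|[|[|[|i]]]] //= lti]; congr pair; apply: val_inj. Qed.

Lemma ccw2_opposite d : ccw (ccw d) = opposite d.
Proof. by case: d => c [[|[|[|[|i]]]] //= lti]; congr pair; apply: val_inj. Qed.

Lemma same_crossing d k : d.1 = k.1 -> k \in [:: d; ccw d; cw d; opposite d].
Proof.
case: d k => [c [i lti]] [c' [j ltj]] /= <-; rewrite !inE !xpair_eqE eqxx -!val_eqE /=.
by case: i lti => [|[|[|[|i]]]] //; case: j ltj => [|[|[|[|j]]]].
Qed.

Lemma same_region_connect_sym :
    involutive (@mate D) -> (forall d, flip (mate d) = flip d) ->
  connect_sym (@same_region D).
Proof.
move=> mateK flip_mate.
have sym k k' : same_region k k' -> same_region k' k.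
  rewrite /same_region /along_left /along_right /= => /orP[]/eqP->.
    by case fk: (flip k); rewrite ?cwK flip_mate fk mateK ?ccwK eqxx ?orbT.
  by case fk: (flip (ccw k)); rewrite ?cwK flip_mate fk mateK ?ccwK eqxx ?orbT.
by apply: sym_connect_sym => k k'; apply/idP/idP; apply: sym.
Qed.

End Darts.

Section Smoothings.
Variable D : diagram.
Implicit Types (d k : dart D) (a b : bool).

Lemma mateK : involutive (@mate D). Proof. by case: (codeP D). Qed.
Lemma mate_neq d : mate d != d. Proof. by case: (codeP D). Qed.
Lemma flip_mate d : flip (mate d) = flip d. Proof. by case: (codeP D). Qed.

Lemma smooth_crossing a d : (smooth a d).1 = d.1.
Proof. by rewrite /smooth; case: ifP. Qed.

Lemma is_over_smooth a d : is_over (smooth a d) = ~~ is_over d.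
Proof. by rewrite /smooth; case: ifP; rewrite ?is_over_cw ?is_over_ccw. Qed.

Lemma smooth_neq a d : smooth a d != d.
Proof. by rewrite /smooth; case: ifP; rewrite ?cw_neq ?ccw_neq. Qed.

Lemma smoothK a : involutive (smooth (D := D) a).
Proof.
move=> d; rewrite {1}/smooth is_over_smooth /smooth.
by case: (is_over d); case: a; rewrite /= ?ccwK ?cwK.
Qed.

Lemma smooth_smooth b d : smooth (~~ b) (smooth b d) = opposite d.
Proof.
rewrite {1}/smooth is_over_smooth /smooth.
by case: (is_over d); case: b; rewrite /= ?cw2_opposite ?ccw2_opposite.
Qed.

Lemma smoothC b d : smooth (~~ b) (smooth b d) = smooth b (smooth (~~ b) d).
Proof. by have := smooth_smooth (~~ b) d; rewrite negbK smooth_smooth => ->. Qed.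

Lemma smooth_block b d k : d.1 = k.1 ->
  k \in [:: d; smooth (~~ b) d; smooth b d; smooth (~~ b) (smooth b d)].
Proof.
move=> /same_crossing; rewrite smooth_smooth /smooth !inE.
by case: (is_over d); case: b => /= /or4P[] ->; rewrite ?orbT.
Qed.

(** Half-arcs of the preimage of the diagram in S^2: the boolean is the sheet, which changes along
    an arc passing through the boundary of the disk. *)
Definition mate_lift (q : dart D * bool) := (mate q.1, q.2 (+) flip q.1).
Definition smooth_lift a (q : dart D * bool) := (smooth a q.1, q.2).
Definition crossing_lift (q : dart D * bool) := (q.1.1, q.2).

Lemma mate_liftK : involutive mate_lift.
Proof. by case=> d s; rewrite /mate_lift /= mateK flip_mate -addbA addbb addbF. Qed.

Lemma smooth_liftK a : involutive (smooth_lift a).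
Proof. by case=> d s; rewrite /smooth_lift /= smoothK. Qed.

Lemma mate_lift_neq q : mate_lift q != q.
Proof. by case: q => d s; rewrite xpair_eqE negb_and mate_neq. Qed.

Lemma smooth_lift_neq a q : smooth_lift a q != q.
Proof. by case: q => d s; rewrite xpair_eqE negb_and smooth_neq. Qed.

(** [b] selects the Tait graph, [true] for G_+ and [false] for G_-. [smooth b] joins the black
    regions at a crossing and [smooth (~~ b)] separates them, so that [set0] yields the boundaries
    of the black regions. *)
Definition circles_rel b H : rel (dart D) :=
  circle_rel fst (@mate D) (smooth (~~ b)) (smooth b) H.
Definition circles b H := n_comp (circles_rel b H) predT.
Definition pieces_rel b H : rel (dart D) :=
  subgraph_rel fst (@mate D) (smooth (~~ b)) (smooth b) H.
Definition subgraph_pieces b H := n_comp (pieces_rel b H) predT.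

Definition lift_set (H : {set crossing D}) : {set crossing D * bool} := setX H setT.
Definition circles_lift_rel b H : rel (dart D * bool) :=
  circle_rel crossing_lift mate_lift (smooth_lift (~~ b)) (smooth_lift b) (lift_set H).
Definition pieces_lift_rel b H : rel (dart D * bool) :=
  subgraph_rel crossing_lift mate_lift (smooth_lift (~~ b)) (smooth_lift b) (lift_set H).
Definition circles_lift b H := n_comp (circles_lift_rel b H) predT.
Definition pieces_lift b H := n_comp (pieces_lift_rel b H) predT.

Lemma circles_rel_sym b H : connect_sym (circles_rel b H).
Proof.
by apply: circle_rel_sym; [exact: mateK|exact: smoothK|exact: smoothK| |]; move=> d; apply: smooth_crossing.
Qed.

Lemma pieces_rel_sym b H : connect_sym (pieces_rel b H).
Proof.
by apply: subgraph_rel_sym; [exact: mateK|exact: smoothK|exact: smoothK|]; move=> d; apply: smooth_crossing.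
Qed.

Lemma crossing_lift_smooth a q : crossing_lift (smooth_lift a q) = crossing_lift q.
Proof. by rewrite /crossing_lift /= smooth_crossing. Qed.

Lemma circles_lift_rel_sym b H : connect_sym (circles_lift_rel b H).
Proof.
by apply: circle_rel_sym; try exact: smooth_liftK; try exact: crossing_lift_smooth; exact: mate_liftK.
Qed.

Lemma pieces_lift_rel_sym b H : connect_sym (pieces_lift_rel b H).
Proof.
by apply: subgraph_rel_sym; try exact: smooth_liftK; try exact: crossing_lift_smooth; exact: mate_liftK.
Qed.

Lemma smooth_lift_block b q r : crossing_lift q = crossing_lift r ->
  r \in [:: q; smooth_lift (~~ b) q; smooth_lift b q; smooth_lift (~~ b) (smooth_lift b q)].
Proof.
case: q r => [d s] [k t] [/(smooth_block b) + ->]; rewrite !inE !xpair_eqE !eqxx.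
by rewrite !andbT.
Qed.

Lemma pieces_circles0 b : subgraph_pieces b set0 = circles b set0.
Proof. exact: subgraph_circle0. Qed.

Lemma crossing_lift_in H q : (crossing_lift q \in lift_set H) = (q.1.1 \in H).
Proof. by rewrite in_setX inE andbT. Qed.

Lemma lift_set0 : lift_set set0 = set0.
Proof. by apply/setP => -[c s]; rewrite !inE. Qed.

Lemma card_lift_set H : #|lift_set H| = (2 * #|H|)%N.
Proof. by rewrite cardsX cardsT card_bool mulnC. Qed.

Lemma pieces_circles_lift0 b : pieces_lift b set0 = circles_lift b set0.
Proof. by rewrite /pieces_lift /circles_lift /pieces_lift_rel /circles_lift_rel lift_set0; exact: subgraph_circle0. Qed.

Lemma pieces_monotone b (H H' : {set crossing D}) : H \subset H' ->
  (2 * subgraph_pieces b H + #|H| + circles b H'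
   <= 2 * subgraph_pieces b H' + #|H'| + circles b H)%N.
Proof.
apply: euler_monotone; try exact: smoothK; try exact: smooth_neq;
  try exact: mateK; try exact: mate_neq; try (by move=> d; apply: smooth_crossing).
- by move=> d; apply: smoothC.
- by move=> c; exists (c, 0).
by move=> d k; apply: smooth_block.
Qed.

Lemma pieces_lift_monotone b (H H' : {set crossing D}) : H \subset H' ->
  (2 * pieces_lift b H + 2 * #|H| + circles_lift b H'
   <= 2 * pieces_lift b H' + 2 * #|H'| + circles_lift b H)%N.
Proof.
move=> sHH'; rewrite -!card_lift_set.
apply: euler_monotone; try exact: smooth_liftK; try exact: smooth_lift_neq;
  try exact: crossing_lift_smooth; try exact: mate_liftK; try exact: mate_lift_neq.
- by move=> q; rewrite /smooth_lift /= smoothC.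
- by move=> [c s]; exists ((c, 0), s).
- by move=> q r; apply: smooth_lift_block.
by apply: setXS.
Qed.

Lemma pieces_cover_proj b H p q : pieces_lift_rel b H p q -> pieces_rel b H p.1 q.1.
Proof.
rewrite /pieces_lift_rel /pieces_rel /subgraph_rel /= ?crossing_lift_in.
by case/or3P=> [/eqP->|/eqP->|/andP[-> /eqP->]]; rewrite eqxx ?orbT.
Qed.

Lemma pieces_cover_lift b H d k : pieces_rel b H d k ->
  exists s, pieces_lift_rel b H (d, false) (k, s).
Proof.
rewrite /pieces_lift_rel /pieces_rel /subgraph_rel /= ?crossing_lift_in.
case/or3P=> [/eqP->|/eqP->|/andP[dH /eqP->]].
- by exists (flip d); rewrite eqxx.
- by exists false; rewrite eqxx orbT.
by exists false; rewrite dH eqxx !orbT.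
Qed.

Lemma pieces_cover_deck b H d k s t : pieces_lift_rel b H (d, s) (k, t) ->
  pieces_lift_rel b H (d, ~~ s) (k, ~~ t).
Proof.
rewrite /pieces_lift_rel /subgraph_rel /= ?crossing_lift_in !xpair_eqE.
by case: s; case: t; case: (flip d).
Qed.

Lemma pieces_lift_le b H : (pieces_lift b H <= 2 * subgraph_pieces b H)%N.
Proof.
apply: cover_n_comp_le; [exact: pieces_rel_sym|exact: pieces_lift_rel_sym| |].
  exact: pieces_cover_lift.
exact: pieces_cover_deck.
Qed.

(* A potential for H lifts the pieces of H to the double cover S^2 of RP^2. *)
Definition potential b (H : {set crossing D}) (chi : dart D -> bool) : Prop :=
  [/\ forall d, chi (mate d) = chi d (+) flip d,
      forall d, chi (smooth (~~ b) d) = chi d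
    & forall d, d.1 \in H -> chi (smooth b d) = chi d].

(** Instance of [cover_n_compP]: a trivialization of the cover, read on each kind of edge, is a
    potential. *)
Lemma pieces_liftP b H :
  reflect (exists chi, potential b H chi) (pieces_lift b H == 2 * subgraph_pieces b H)%N.
Proof.
have P : reflect (exists chi : dart D -> bool, forall p q,
    pieces_lift_rel b H p q -> p.2 (+) chi p.1 = q.2 (+) chi q.1)
    (pieces_lift b H == 2 * subgraph_pieces b H)%N.
  apply: cover_n_compP; [exact: pieces_rel_sym|exact: pieces_lift_rel_sym| | |].
  - exact: pieces_cover_proj.
  - exact: pieces_cover_lift.
  exact: pieces_cover_deck.
apply: (iffP P) => -[chi chiP]; exists chi.
  have step d s k t : pieces_lift_rel b H (d, s) (k, t) -> s (+) chi d = t (+) chi k.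
    exact: chiP.
  split=> [d|d|d dH].
  - have := step d (flip d) (mate d) false; rewrite addFb addbC => -> //.
    by rewrite /pieces_lift_rel /subgraph_rel /mate_lift /= addbb eqxx.
  - apply/esym/(step d false _ false).
    by rewrite /pieces_lift_rel /subgraph_rel /= eqxx orbT.
  apply/esym/(step d false _ false).
  by rewrite /pieces_lift_rel /subgraph_rel /= crossing_lift_in dH eqxx !orbT.
case: chiP => chi_mate chi_0 chi_1 [d s] q.
rewrite /pieces_lift_rel /subgraph_rel /= ?crossing_lift_in.
case/or3P=> [/eqP->|/eqP->|/andP[dH /eqP->]] /=.
- by rewrite chi_mate; case: s; case: (flip d); case: (chi d).
- by rewrite chi_0.
by rewrite chi_1.
Qed.

Hypothesis altD : alternating_diagram D.

Lemma is_over_mate d : is_over (mate d) = is_over d (+) ~~ flip d.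
Proof. by rewrite -altD; case: (is_over d); case: (is_over _). Qed.

(* In an alternating diagram, the lift of the circles to S^2 is their bipartite
   double cover, hence trivial. *)
Lemma circle_potential b H : exists chi : dart D -> bool,
  (forall d, chi (mate d) = chi d (+) flip d)
  /\ forall d, chi (smoothed fst (smooth (~~ b)) (smooth b) H d) = chi d.
Proof.
have smK : involutive (smoothed fst (smooth (~~ b)) (smooth b) H).
  by apply: smoothedK; try exact: smoothK; move=> d; apply: smooth_crossing.
have sm_neq d : smoothed fst (smooth (~~ b)) (smooth b) H d != d.
  by apply: smoothed_neq; exact: smooth_neq.
have [chi chiP] := involutions_bipartite mateK smK mate_neq sm_neq.
(* Both [chi] and [is_over] change at a smoothing. Along an arc [chi] always changes and [is_over]
   only if the arc is not flipped, so their sum changes exactly on flipped arcs. *)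
exists (fun d => chi d (+) is_over d); split=> d; have [chi_m chi_s] := chiP d.
  by rewrite chi_m is_over_mate; case: (chi d); case: (is_over d); case: (flip d).
rewrite chi_s; have -> : is_over (smoothed fst (smooth (~~ b)) (smooth b) H d) = ~~ is_over d.
  by rewrite /smoothed; case: ifP; rewrite is_over_smooth.
by case: (chi d); case: (is_over d).
Qed.

(** [circle_potential] trivializes the cover: topologically, all state circles are
    null-homotopic. *)
Lemma circles_liftE b H : circles_lift b H = (2 * circles b H)%N.
Proof.
apply/eqP/cover_n_compP; [exact: circles_rel_sym|exact: circles_lift_rel_sym| | | |].
- move=> p q; rewrite /circles_lift_rel /circles_rel /circle_rel /smoothed /= ?crossing_lift_in.
  by case/orP=> /eqP->; rewrite ?eqxx // /=; case: ifP; rewrite eqxx orbT.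
- move=> d k; rewrite /circles_lift_rel /circles_rel /circle_rel /smoothed /= ?crossing_lift_in.
  case/orP=> /eqP->; first by exists (flip d); rewrite eqxx.
  by exists false; case: ifP; rewrite eqxx orbT.
- move=> d k s t; rewrite /circles_lift_rel /circle_rel /smoothed /= ?crossing_lift_in /=.
  by case: ifP; rewrite !xpair_eqE; case: s; case: t; case: (flip d).
have [chi [chi_m chi_s]] := circle_potential b H; exists chi => -[d s] q.
rewrite /circles_lift_rel /circle_rel /smoothed /= ?crossing_lift_in.
case/orP=> /eqP->; first by rewrite /= chi_m; case: s; case: (flip d); case: (chi d).
by have := chi_s d; rewrite /smoothed; case: ifP => _ /= ->.
Qed.

Lemma circlesC b H : circles b H = circles (~~ b) (~: H).
Proof.
apply: eq_n_comp; apply: eq_connect => d k.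
by rewrite /circles_rel /circle_rel /smoothed /= in_setC negbK; case: ifP.
Qed.

Lemma circles_setT b : circles b setT = circles (~~ b) set0.
Proof. by have := circlesC b setT; rewrite setCT. Qed.

(* The excess 2 * pieces - circles + #|H| - V counts the pieces of H which are
   essential: in S^2 the Euler characteristic makes it vanish, and in RP^2 it
   is at most 1. *)
Lemma circles_pieces b H :
    subgraph_pieces b setT = 1%N -> (pieces_lift b setT <= 1)%N ->
    (#|crossing D| + 1 <= circles b set0 + circles b setT)%N ->
  [/\ (circles b H + circles b set0 = pieces_lift b H + #|H|)%N,
      (2 * subgraph_pieces b H <= pieces_lift b H + 1)%N
    & (circles b set0 + circles b setT = #|crossing D| + 1)%N].
Proof.
move=> kT klT leF.
(* In S^2 the monotone quantity cannot end above its initial value, by the bounds on [pieces_lift]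
   and on the circles, so it is constant. In RP^2 its final value exceeds the initial one by 1,
   which bounds twice the pieces of [H] minus their lifts. *)
have := pieces_lift_monotone b (sub0set H); have := pieces_lift_monotone b (subsetT H).
have := pieces_lift_monotone b (sub0set setT).
have := pieces_monotone b (subsetT H).
by rewrite !pieces_circles_lift0 !circles_liftE kT !cards0 cardsT; split; lia.
Qed.

(** [H] and its complement describe the same state. Adding the two circle formulas, with V_+ + V_- =
    E + 1, makes the two numbers of lifted pieces add up to an odd number; as each is 2k or 2k - 1,
    with k the number of pieces, exactly one of them is 2k. *)
Lemma exactly_one_balanced b H :
    (forall a, subgraph_pieces a setT = 1%N) -> (forall a, pieces_lift a setT <= 1)%N ->
    (#|crossing D| + 1 <= circles b set0 + circles b setT)%N ->
  (pieces_lift b H == 2 * subgraph_pieces b H)%N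
  = (pieces_lift (~~ b) (~: H) != 2 * subgraph_pieces (~~ b) (~: H))%N.
Proof.
move=> kT klT leF; have Eb := circles_setT b; have Enb := circles_setT (~~ b); rewrite negbK in Enb.
have leF' : (#|crossing D| + 1 <= circles (~~ b) set0 + circles (~~ b) setT)%N.
  by move: Eb Enb leF; lia.
have [c1 k1 F1] := circles_pieces H (kT b) (klT b) leF.
have [c2 k2 _] := circles_pieces (~: H) (kT (~~ b)) (klT (~~ b)) leF'.
have := pieces_lift_le b H; have := pieces_lift_le (~~ b) (~: H).
move: c1 c2 k1 k2 F1; rewrite -circlesC Eb; have := cardsC H; lia.
Qed.

End Smoothings.

(** * Regions and Tait graphs *)

Section Regions.
Variable D : diagram.
Hypothesis altD : alternating_diagram D.
Implicit Types (d k : dart D) (H : {set crossing D}).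

Lemma same_region_sym : connect_sym (@same_region D).
Proof. by apply: same_region_connect_sym; [exact: mateK|exact: flip_mate]. Qed.

Section Color.
Variables (b : bool) (black : dart D -> bool).
Hypothesis blackE : forall k, black k = (is_over k == b).

(** The smoothing [~~ b] cuts off the black corners: its circles follow the boundaries of black
    regions. *)
Lemma smooth_corner k : black k -> smooth (~~ b) k = ccw k.
Proof. by rewrite blackE /smooth => /eqP->; case: b. Qed.

Lemma smooth_white k : ~~ black k -> smooth (~~ b) k = cw k.
Proof. by rewrite blackE /smooth; case: (is_over k); case: b. Qed.

Lemma black_ccw k : black (ccw k) = ~~ black k.
Proof. by rewrite !blackE is_over_ccw; case: (is_over k); case: b. Qed.

Lemma black_cw k : black (cw k) = ~~ black k.
Proof. by rewrite !blackE is_over_cw; case: (is_over k); case: b. Qed.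

Lemma black_mate k : black (mate k) = black k (+) ~~ flip k.
Proof.
by rewrite !blackE is_over_mate //; case: (is_over k); case: (flip k); case: b.
Qed.

Lemma black_same_region k k' : same_region k k' -> black k = black k'.
Proof.
rewrite /same_region /along_left /along_right => /orP[] /eqP->.
  by case fk: (flip k); rewrite ?black_cw black_mate fk; case: (black k).
by case fk: (flip _); rewrite ?black_cw black_mate fk black_ccw; case: (black k).
Qed.

Lemma black_region k : black (region k) = black k.
Proof.
apply/esym; apply: (connect_preserve (f := black) black_same_region).
exact: connect_root.
Qed.

(** Moving along an arc inside a black region is [mate], up to the smoothing [~~ b]. With [tw]
    trivial this transports connected components, with [tw] the exclusive or it transports
    potentials. *)
Lemma black_along (S : Type) (tw : bool -> S -> S) (f : dart D -> S) k k' :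
    (forall d, f (mate d) = tw (flip d) (f d)) ->
    (forall d, f (smooth (~~ b) d) = f d) -> black k ->
  (k' = along_left k -> f k' = tw (flip k) (f k))
  /\ (k' = along_right k -> f k' = tw (flip (ccw k)) (f k)).
Proof.
move=> f_mate f_smooth bk.
have f_ccw : f (ccw k) = f k by rewrite -smooth_corner.
split=> ->; rewrite /along_left /along_right.
  rewrite -f_mate; case: ifP => // fk.
  by rewrite -smooth_white // black_mate fk bk.
rewrite -f_ccw -f_mate; case: ifP => // fk.
by rewrite -smooth_white // black_mate fk black_ccw bk.
Qed.

Lemma same_region_pieces H k k' : black k -> connect (@same_region D) k k' ->
  connect (pieces_rel b H) k k'.
Proof.
move=> bk kk'; have sym := pieces_rel_sym b H.
pose f k := if black k then Some (croot (pieces_rel b H) k) else None.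
suff : f k = f k'.
  rewrite /f bk; have -> : black k' = true.
    by rewrite -(connect_preserve (f := black) black_same_region kk').
  by case=> /(fingraph.rootP sym).
apply: (connect_preserve (f := f)) kk' => {k k' bk} k k' kk'.
rewrite /f -(black_same_region kk'); case: ifP => // bk; congr Some.
have [||fl fr] := @black_along _ (fun _ => id) (croot (pieces_rel b H)) k k' _ _ bk.
- move=> d; apply/esym/(fingraph.rootP sym)/connect1.
  by rewrite /pieces_rel /subgraph_rel /= eqxx.
- move=> d; apply/esym/(fingraph.rootP sym)/connect1.
  by rewrite /pieces_rel /subgraph_rel /= eqxx orbT.
by case/orP: kk' => /eqP kk'; apply/esym; [exact: fl|exact: fr].
Qed.

(** A potential determines the sheet along every path inside a black region, which makes the parity
    independent of the path and computes it. *)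
Lemma region_parityE (chi : dart D -> bool) k :
    (forall d, chi (mate d) = chi d (+) flip d) ->
    (forall d, chi (smooth (~~ b) d) = chi d) -> black k ->
  region_parity k = chi (region k) (+) chi k.
Proof.
move=> chi_mate chi_smooth bk.
pose f (q : dart D * bool) := (black q.1, black q.1 && (q.2 (+) chi q.1)).
have fE p q : same_region_lift p q -> f p = f q.
  case: p q => [d s] [d' s']; rewrite /f /same_region_lift /= => dd'.
  have rd : same_region d d'.
    by case/orP: dd' => /eqP[-> _]; rewrite /same_region /= eqxx ?orbT.
  rewrite -(black_same_region rd); case bd: (black d) => //=; congr pair.
  have [||fl fr] := @black_along _ (fun x y => y (+) x) chi d d' _ _ bd => //.
  by case/orP: dd' => /eqP[dd' ->]; [rewrite fl|rewrite fr] => //;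
    case: (flip _); case: s; case: (chi d).
have kr : connect (@same_region D) (region k) k.
  by rewrite same_region_sym connect_root.
have proj p q : connect (@same_region_lift D) p q -> f p = f q.
  exact: connect_preserve.
have [s ks] : exists s, connect (@same_region_lift D) (region k, false) (k, s).
  apply: connect_cover_lift kr.
  - move=> d d'; rewrite /same_region /= => /orP[]/eqP->.
      by exists (flip d); rewrite /same_region_lift /= eqxx.
    by exists (flip (ccw d)); rewrite /same_region_lift /= eqxx orbT.
  move=> d d' s t; rewrite /same_region_lift /= !xpair_eqE.
  by case: s; case: t; case: (flip d); case: (flip (ccw d)).
have fks t : connect (@same_region_lift D) (region k, false) (k, t) ->
    t = chi (region k) (+) chi k.
  move=> /proj; rewrite /f /= black_region bk /= => -[->].
  by case: t; case: (chi k).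
rewrite /region_parity -(fks s ks); case: s ks => // ks.
by apply/negP => /fks; rewrite -(fks _ ks).
Qed.

(** A half-arc has the corners [d] and [cw d] on its two sides, of which exactly one is black. *)
Definition corner d := if black d then d else cw d.

Lemma black_corner_of d : black (corner d).
Proof. by rewrite /corner; case: ifP => // /negbT; rewrite black_cw. Qed.

Lemma corner_smooth d : corner (smooth (~~ b) d) = corner d.
Proof.
rewrite /corner; case bd: (black d).
  by rewrite smooth_corner // black_ccw bd /= ccwK.
by rewrite smooth_white ?bd // black_cw bd.
Qed.

Lemma region_corner_mate d : region (corner (mate d)) = region (corner d).
Proof.
apply/esym/(fingraph.rootP same_region_sym)/connect1.
rewrite /corner black_mate; case bd: (black d); case fd: (flip d) => /=.
- by rewrite /same_region /along_left /= fd eqxx.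
- by rewrite /same_region /along_left /= fd eqxx.
- by rewrite /same_region /along_right /= cwK fd eqxx orbT.
by rewrite /same_region /along_right /= cwK fd eqxx orbT.
Qed.

Lemma smooth_black k : black k -> smooth b k = cw k.
Proof. by rewrite blackE /smooth => ->. Qed.

Lemma black_opposite k : black (opposite k) = black k.
Proof. by rewrite -cw2_opposite !black_cw negbK. Qed.

Lemma black_corner_black c : black (black_corner black c).
Proof. by rewrite blackE /black_corner blackE; case: b. Qed.

Let G := tait black.

(** An edge can be read from either of the two black corners of its crossing; the choice only
    exchanges its ends. *)
Lemma tait_region_opposite k : black k ->
  [/\ src G k.1 = region k, tgt G k.1 = region (opposite k)
    & odd_edge G k.1 = region_parity k (+) region_parity (opposite k)] \/
  [/\ src G k.1 = region (opposite k), tgt G k.1 = region k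
    & odd_edge G k.1 = region_parity k (+) region_parity (opposite k)].
Proof.
move=> bk; pose c := k.1.
have oppK d : opposite (opposite d) = d.
  by rewrite -!cw2_opposite; case: d => d [[|[|[|[|i]]]] //= lti]; congr pair; apply: val_inj.
have : k = black_corner black c \/ k = opposite (black_corner black c).
  have : black_corner black c \in [:: k; ccw k; cw k; opposite k] by apply: same_crossing.
  have bc := black_corner_black c.
  rewrite !inE => /or4P[]/eqP E; rewrite E ?oppK; [by left| | |by right].
    by rewrite E black_ccw bk in bc.
  by rewrite E black_cw bk in bc.
case=> kE; [left|right].
  by split; rewrite /G /tait /= -/c -kE.
have cE : black_corner black c = opposite k by rewrite kE oppK.
by split; rewrite /G /tait /= -/c cE ?oppK // addbC.
Qed.

Lemma smooth_piece k H : black k -> k.1 \in H -> connect (pieces_rel b H) k (opposite k).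
Proof.
move=> bk kH; apply: (@connect_trans _ _ (smooth b k)); apply: connect1.
  by rewrite /pieces_rel /subgraph_rel /= kH eqxx !orbT.
by rewrite /pieces_rel /subgraph_rel /= smooth_smooth eqxx orbT.
Qed.

Lemma piece_corner H d : connect (pieces_rel b H) d (corner d).
Proof.
rewrite /corner; case bd: (black d); first exact: connect0.
rewrite -smooth_white ?bd //; apply: connect1.
by rewrite /pieces_rel /subgraph_rel /= eqxx orbT.
Qed.

Lemma piece_region H k : black k -> connect (pieces_rel b H) k (region k).
Proof. by move=> bk; apply: same_region_pieces => //; apply: connect_root. Qed.

(** [smooth b] leads over to the opposite black corner, as the edge of the Tait graph does. *)
Lemma smooth_edge d : exists2 k, black k & k.1 = d.1 /\
  (corner d = k /\ corner (smooth b d) = opposite k).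
Proof.
exists (corner d); first exact: black_corner_of.
split; first by rewrite /corner; case: ifP.
split=> //; rewrite /corner; case bd: (black d).
  by rewrite smooth_black // black_cw bd /= cw2_opposite.
have -> : smooth b d = ccw d.
  by move: bd; rewrite blackE /smooth => ->.
rewrite black_ccw bd /=; rewrite -cw2_opposite.
by case: d {bd} => d [[|[|[|[|i]]]] //= lti]; congr pair; apply: val_inj.
Qed.

(** Sending a half-arc to the region of its black corner is bijective on components: [mate] and
    [smooth (~~ b)] stay in the region, and [smooth b] at a crossing of [H] follows an edge of
    [H]. *)
Lemma tait_components H : components G H = subgraph_pieces b H.
Proof.
have symG := reach_sym G H; have symP := pieces_rel_sym b H.
apply: (n_comp_retract (h := fun d => region (corner d))) => //.
- apply: adjacent_closed => c _; split; apply: imset_f; rewrite inE.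
    exact: black_corner_black.
  by rewrite black_opposite black_corner_black.
- by move=> d; apply: imset_f; rewrite inE; exact: black_corner_of.
- move=> d d'; apply/idP/idP => [|dd'].
    move=> dd'; apply/(fingraph.rootP symG).
    apply: (connect_preserve (f := fun d => croot _ (region (corner d)))) dd'.
    move=> {d d'} d d'; rewrite /pieces_rel /subgraph_rel /=.
    case/or3P=> [/eqP->|/eqP->|/andP[dH /eqP->]].
    + by rewrite region_corner_mate.
    + by rewrite corner_smooth.
    have [k bk [kd [-> ->]]] := smooth_edge d.
    apply/(fingraph.rootP symG).
    have := reach_edge G dH; rewrite -kd.
    by case: (tait_region_opposite bk) => -[-> -> _] //; rewrite /reach symG.
  have toP x : connect (pieces_rel b H) x (region (corner x)).
    by apply: connect_trans (piece_corner H x) (piece_region H _); exact: black_corner_of.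
  apply: connect_trans (toP d) _; rewrite symP; apply: connect_trans (toP d') _.
  rewrite symP; apply: connect_sub dd' => u v /adjacentP[c cH uv].
  have bc := black_corner_black c.
  have cE : connect (pieces_rel b H) (src G c) (tgt G c).
    have boc : black (opposite (black_corner black c)) by rewrite black_opposite.
    have ck : connect (pieces_rel b H) (region (black_corner black c)) (black_corner black c).
      by rewrite symP; apply: piece_region.
    exact: connect_trans (connect_trans ck (smooth_piece bc cH)) (piece_region H boc).
  by case: uv => -[<- <-] //; rewrite symP.
move=> _ /imsetP[k bk ->]; exists k; rewrite inE in bk.
by rewrite /corner bk; exact: connect0.
Qed.

(** Potentials on regions and on half-arcs correspond. The potential [phi] of the state [set0]
    exists on all black boundaries and measures the sheet relative to the base corner; adding it
    extends a potential from base corners to half-arcs. Conversely, a potential on half-arcs is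
    restricted to base corners. *)
Lemma tait_balanced H :
  balanced G H = (pieces_lift b H == 2 * subgraph_pieces b H)%N.
Proof.
apply/balancedP/pieces_liftP => -[chi].
  move=> chiP; have [phi [phi_mate phi_s]] := circle_potential altD b set0.
  have phi_smooth d : phi (smooth (~~ b) d) = phi d.
    by have := phi_s d; rewrite /smoothed inE.
  exists (fun d => chi (region (corner d)) (+) phi (region (corner d)) (+) phi d).
  split=> [d|d|d dH].
  - by rewrite region_corner_mate phi_mate addbA.
  - by rewrite corner_smooth phi_smooth.
  have phiC x : phi (corner x) = phi x.
    by rewrite /corner; case bx: (black x) => //; rewrite -smooth_white ?bx.
  rewrite -(phiC d) -(phiC (smooth b d)).
  have [k bk [kd [-> ->]]] := smooth_edge d.
  have bok : black (opposite k) by rewrite black_opposite.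
  have := chiP _ dH; rewrite -kd.
  case: (tait_region_opposite bk) => -[-> -> ->];
    rewrite !(region_parityE phi_mate phi_smooth) //;
    case: (chi (region k)); case: (chi (region _)); case: (phi (region k));
    by case: (phi (region _)); case: (phi k); case: (phi _).
case=> chi_mate chi_smooth chi_H; exists chi => c cH.
have bc := black_corner_black c.
have := chi_H (black_corner black c) cH; rewrite smooth_black //.
have -> : chi (cw (black_corner black c)) = chi (opposite (black_corner black c)).
  by rewrite -cw2_opposite -[in RHS]smooth_white ?chi_smooth // black_cw bc.
rewrite /= !(region_parityE chi_mate chi_smooth) ?black_opposite //.
move=> ->; case: (chi (black_corner _ _)); case: (chi (region _)) => /=;
  by case: (chi _).
Qed.

Lemma tait_card_vertices : #|vertices G| = circles b (set0 : {set crossing D}).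
Proof. by rewrite -components_edgeless tait_components pieces_circles0. Qed.

Lemma tait_ends_in_vertices H : ends_in_vertices G H.
Proof.
move=> c _; split; apply: imset_f; rewrite inE; first exact: black_corner_black.
by rewrite black_opposite black_corner_black.
Qed.

Lemma n_comp_black_regions :
  n_comp (@same_region D) [pred k | black k] = #|vertices G|.
Proof.
by apply: n_comp_root => // [|k k']; [exact: same_region_sym|exact: black_same_region].
Qed.

End Color.

(** The two colorings are complementary, so each region is a vertex of exactly one Tait graph. *)
Lemma n_comp_regions :
  n_comp (@same_region D) predT = (circles true (set0 : {set crossing D}) + circles false (set0 : {set crossing D}))%N.
Proof.
have E1 (k : dart D) : is_over k = (is_over k == true) by case: is_over.
have E0 (k : dart D) : ~~ is_over k = (is_over k == false) by case: is_over.
rewrite (n_compC [pred k | is_over k]).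
rewrite (n_comp_black_regions E1) (tait_card_vertices E1).
congr (_ + _)%N; rewrite -(tait_card_vertices E0) -(n_comp_black_regions E0).
by apply: eq_n_comp_r => k; rewrite !inE.
Qed.

(** With all edges present, the four half-arcs of a crossing lie in one piece, and only the
    connections through arcs remain. *)
Lemma pieces_joined b : subgraph_pieces b [set: crossing D] = n_comp (@joined D) predT.
Proof.
have sym_j : connect_sym (@joined D).
  have sym (c c' : crossing D) : joined c c' -> joined c' c.
    case/existsP=> i /eqP ci; apply/existsP; exists (mate (c, i)).2.
    have -> : (c', (mate (c, i)).2) = mate (c, i) by rewrite -ci; case: (mate _).
    by rewrite mateK.
  by apply: sym_connect_sym => c c'; apply/idP/idP; apply: sym.
have symP := pieces_rel_sym b [set: crossing D].
apply/esym; apply: (n_comp_retract (h := fun d => d.1)) => //; last first.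
  by move=> c _; exists (c, 0); exact: connect0.
have toP d d' : d.1 = d'.1 -> connect (pieces_rel b [set: crossing D]) d d'.
  have sm0 x : connect (pieces_rel b [set: crossing D]) x (smooth (~~ b) x).
    by apply: connect1; rewrite /pieces_rel /subgraph_rel /= eqxx orbT.
  have sm1 x : connect (pieces_rel b [set: crossing D]) x (smooth b x).
    by apply: connect1; rewrite /pieces_rel /subgraph_rel /= inE eqxx !orbT.
  move=> /(smooth_block b); rewrite !inE => /or4P[]/eqP->; rewrite ?connect0 //.
  exact: connect_trans (sm1 _) (sm0 _).
move=> d d'; apply/idP/idP => [dd'|].
  apply/(fingraph.rootP sym_j).
  apply: (connect_preserve (f := fun d => croot (@joined D) d.1)) dd' => x y.
  rewrite /pieces_rel /subgraph_rel /=.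
  case/or3P=> [/eqP->|/eqP->|/andP[_ /eqP->]]; rewrite ?smooth_crossing //.
  apply/(fingraph.rootP sym_j)/connect1/existsP; exists x.2.
  by case: x.
move=> dd'; have := toP (d.1, 0) d erefl; rewrite symP => /connect_trans; apply.
apply: connect_trans (toP (d'.1, 0) d' erefl); apply/(fingraph.rootP symP).
apply: (connect_preserve (f := fun c => croot (pieces_rel b [set: crossing D]) (c, 0))) dd'.
move=> c c' /existsP[i /eqP <-]; apply/(fingraph.rootP symP).
have c0i : connect (pieces_rel b [set: crossing D]) (c, 0) (c, i) by apply: toP.
apply: connect_trans c0i _.
apply: (@connect_trans _ _ (mate (c, i))); last exact: toP.
by apply: connect1; rewrite /pieces_rel /subgraph_rel /= eqxx.
Qed.

End Regions.

(** * Diagrams with a trivial double cover are local *)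

Lemma connect_homo (T T' : finType) (e : rel T) (e' : rel T') (h : T -> T') :
    (forall x y, e x y -> e' (h x) (h y)) ->
  forall x y, connect e x y -> connect e' (h x) (h y).
Proof.
move=> eh x y /connectP[p]; elim: p x => [x _ -> //|z p IHp x] /=.
case/andP=> /eh/connect1 xz zp zy; exact: connect_trans xz (IHp z zp zy).
Qed.

Lemma n_comp_conjugate (T : finType) (e e' : rel T) (h : T -> T) :
    connect_sym e -> connect_sym e' -> involutive h ->
    (forall x y, e (h x) (h y) = e' x y) ->
  n_comp e predT = n_comp e' predT.
Proof.
move=> sym_e sym_e' hK he; apply: (n_comp_retract (h := h)) => // [x y|x _].
  apply/idP/idP => [|xy]; first by apply: connect_homo => {}x {}y; rewrite he.
  rewrite -[x]hK -[y]hK; apply: connect_homo xy => u v.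
  by rewrite -{1}[u]hK -{1}[v]hK he.
by exists (h x); rewrite hK connect0.
Qed.

Section Untwist.
Variables (D : diagram) (eps : crossing D -> bool).
Hypothesis eps_flip : forall d : dart D, flip d = eps d.1 (+) eps (mate d).1.
Hypothesis no_essential : essential_circles D = 0%N.
Implicit Types d k : dart D.

(** The effect of pushing a crossing through the boundary: i -> 1 - i reverses the cyclic order and,
    the constant being odd, exchanges over and under. *)
Definition turn d : dart D := if eps d.1 then (d.1, 1 - d.2) else d.

Lemma turnK : involutive turn.
Proof.
case=> c i; rewrite /turn /=; case ec: (eps c) => /=; rewrite ?ec //.
by rewrite opprB addrC subrK.
Qed.

Lemma turn_crossing d : (turn d).1 = d.1.
Proof. by rewrite /turn; case: ifP. Qed.

Definition untwisted_code : pd_code :=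
  @PDCode (crossing D) (fun d => turn (mate (turn d))) (fun=> false)
    (null_circles D) (essential_circles D).

(* The corner between d and ccw d becomes the one between turn (ccw d) and
   turn d. *)
Definition turn_corner k : dart D := if eps k.1 then turn (ccw k) else k.

Lemma turn_corner_crossing k : (turn_corner k).1 = k.1.
Proof. by rewrite /turn_corner; case: ifP; rewrite ?turn_crossing. Qed.

Lemma turn_ccw d : turn (ccw d) = if eps d.1 then cw (turn d) else ccw (turn d).
Proof.
rewrite /turn /=; case: ifP => // _.
by rewrite /cw /ccw /= opprD addrA.
Qed.

Lemma turn_cw d : turn (cw d) = if eps d.1 then ccw (turn d) else cw (turn d).
Proof.
rewrite /turn /=; case: ifP => // _.
by rewrite /cw /ccw /= opprB addrA [in RHS]addrAC.
Qed.

Lemma turn_cornerK : involutive turn_corner.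
Proof.
move=> k; rewrite {1}/turn_corner turn_corner_crossing.
rewrite /turn_corner; case ek: (eps k.1) => //.
by rewrite turn_ccw turn_crossing /= ek turnK ccwK.
Qed.

Lemma is_over_turn d : is_over (turn d) = is_over d (+) eps d.1.
Proof.
rewrite /turn; case: (eps d.1); rewrite ?addbF //.
by case: d => c [[|[|[|[|i]]]] //= lti].
Qed.

(** Turning a crossing reverses its orientation, hence exchanges the two ways around a region. *)
Lemma turn_corner_along k :
  turn_corner (along_left k) = (if eps k.1 then @along_right untwisted_code (turn_corner k)
                                else @along_left untwisted_code (turn_corner k))
  /\ turn_corner (along_right k) = (if eps k.1 then @along_left untwisted_code (turn_corner k)
                                else @along_right untwisted_code (turn_corner k)).
Proof.
have cornerE m : turn_corner m = if eps m.1 then cw (turn m) else turn m.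
  by rewrite /turn_corner turn_ccw /turn; case: (eps m.1).
have corner_cwE m : turn_corner (cw m) = if eps m.1 then turn m else cw (turn m).
  by rewrite cornerE turn_cw /=; case: (eps m.1); rewrite ?ccwK.
have alE x : @along_left untwisted_code x = cw (turn (mate (turn x))) by [].
have arE x : @along_right untwisted_code x = turn (mate (turn (ccw x))) by [].
rewrite !alE !arE /along_left /along_right (eps_flip k) (eps_flip (ccw k)) /=.
have -> : turn (turn_corner k) = if eps k.1 then ccw k else k.
  by rewrite /turn_corner; case ek: (eps k.1); rewrite ?turnK // /turn ek.
have -> : turn (ccw (turn_corner k)) = if eps k.1 then k else ccw k.
  rewrite cornerE; case ek: (eps k.1); rewrite ?cwK ?turnK // /turn ek /=.
  by rewrite ek.
by case: (eps k.1); split; case em: (eps (mate _).1); rewrite /= ?corner_cwE ?cornerE em.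
Qed.

Lemma turn_same_region k k' :
  @same_region untwisted_code (turn_corner k) (turn_corner k') = same_region k k'.
Proof.
have [Ll Lr] := turn_corner_along k; rewrite /same_region /=.
rewrite -[k' == along_left k](inj_eq (inv_inj turn_cornerK)).
rewrite -[k' == along_right k](inj_eq (inv_inj turn_cornerK)) Ll Lr.
by case: ifP; rewrite // orbC.
Qed.

Lemma untwisted_joined : @joined untwisted_code =2 @joined D.
Proof.
have turn_pair (c : crossing D) i : turn (c, i) = (c, (turn (c, i)).2).
  by rewrite [LHS]surjective_pairing turn_crossing.
move=> c c'; rewrite /joined /=; apply/existsP/existsP => -[i /eqP ci];
    exists (turn (c, i)).2; rewrite -turn_pair.
  by rewrite -ci turn_crossing.
by rewrite turnK turn_crossing ci.
Qed.

Lemma untwisted_axiom : pd_axiom untwisted_code.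
Proof.
have mateK' : involutive (@mate untwisted_code).
  by move=> d; rewrite /= turnK mateK turnK.
split=> // [d|]; first by rewrite /= -(inj_eq (inv_inj turnK)) turnK mate_neq.
have [_ _ _] := codeP D; rewrite /drawn_on_RP2 /=.
rewrite (eq_n_comp (eq_connect untwisted_joined)).
have sym' : connect_sym (@same_region untwisted_code).
  exact: same_region_connect_sym.
have sym : connect_sym (@same_region D).
  by apply: same_region_connect_sym; [exact: mateK|exact: flip_mate].
by rewrite -(n_comp_conjugate sym' sym turn_cornerK turn_same_region).
Qed.

Definition untwisted : diagram := Diagram untwisted_axiom.

Lemma untwist_isotopy : isotopy_move D untwisted.
Proof.
exists eps, turn; split=> //.
- by exists turn; exact: turnK.
- exact: turn_ccw.
- exact: is_over_turn.
move=> d; split; first by rewrite /= turnK.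
by rewrite /= eps_flip; case: (eps d.1); case: (eps _).
Qed.

Lemma local_untwist : local_link D.
Proof.
exists untwisted; split; last by split.
by apply: Relation_Operators.rst_step; constructor 1; exact: untwist_isotopy.
Qed.

End Untwist.

(** * The Jones polynomial *)

Lemma n_comp_gt0 (T : finType) (e : rel T) (x : T) :
  connect_sym e -> (0 < n_comp e predT)%N.
Proof.
move=> sym_e; apply/card_gt0P; exists (croot e x).
by rewrite !inE roots_root.
Qed.

Section Circles.
Variable D : diagram.

Lemma eq_state_circles (s s' : crossing D -> bool) :
  s =1 s' -> state_circles s = state_circles s'.
Proof.
move=> ss'; have E : connect [rel d d' : dart D | (d' == mate d) || (d' == smooth (s d.1) d)]
    =2 connect [rel d d' : dart D | (d' == mate d) || (d' == smooth (s' d.1) d)].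
  by apply: eq_connect => d k /=; rewrite ss'.
by rewrite /state_circles (eq_n_comp E).
Qed.

Hypothesis altD : alternating_diagram D.
Hypotheses (D_joined : n_comp (@joined D) predT = 1%N)
  (D_essential : essential_circles D = 0%N).

Lemma circles_gt0 b (H : {set crossing D}) : (0 < circles b H)%N.
Proof.
have /card_gt0P[c _] : (0 < n_comp (@joined D) predT)%N by rewrite D_joined.
by apply: n_comp_gt0 (c, 0) _; exact: circles_rel_sym.
Qed.

Hypothesis D_nonlocal : ~ local_link D.

(** A connected diagram has one or two lifts to S^2. If there are two, the potential is constant at
    each crossing and has [flip] as coboundary; pushing the crossings where it is true through the
    boundary then makes the link local. *)
Lemma pieces_lift_setT b : (pieces_lift b [set: crossing D] <= 1)%N.
Proof.
have k1 : subgraph_pieces b [set: crossing D] = 1%N by rewrite pieces_joined.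
have := pieces_lift_le b [set: crossing D]; rewrite k1 leq_eqVlt ltnS.
case/orP=> // k2; case: D_nonlocal.
have /pieces_liftP[chi [chi_mate chi_0 chi_1]] :
  (pieces_lift b [set: crossing D] == 2 * subgraph_pieces b [set: crossing D])%N.
  by rewrite k1.
have chi_crossing d k : d.1 = k.1 -> chi d = chi k.
  move=> /(smooth_block b); rewrite !inE => /or4P[]/eqP->; rewrite ?chi_0 ?chi_1 ?inE //.
apply: (@local_untwist _ (fun c => chi (c, 0))) => // d.
rewrite (chi_crossing (d.1, 0) d erefl) (chi_crossing ((mate d).1, 0) (mate d) erefl).
by rewrite chi_mate; case: (chi d); case: (flip d).
Qed.

(** [drawn_on_RP2] gives at least one region more than there are crossings, and the connected lift
    to S^2 gives the opposite bound in [circles_pieces]. *)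
Lemma circles_euler :
  (circles true (set0 : {set crossing D}) + circles false (set0 : {set crossing D})
   = #|crossing D| + 1)%N
  /\ (circles true (set0 : {set crossing D}) + circles true [set: crossing D]
   = #|crossing D| + 1)%N.
Proof.
have E : circles true [set: crossing D] = circles false set0 := circles_setT D true.
have [_ _ _] := codeP D; rewrite /drawn_on_RP2 D_essential D_joined (n_comp_regions altD) => leF.
have [||] := @circles_pieces D altD true set0 _ (pieces_lift_setT true).
- by rewrite pieces_joined.
- by rewrite E; move: leF; lia.
by case=> _ _ euler; rewrite -E; split; exact: euler.
Qed.

Lemma state_circles_set (H : {set crossing D}) : null_circles D = 0%N ->
  state_circles (fun c => c \in H) = circles true H.
Proof.
move=> D_null; rewrite /state_circles D_null D_essential !addn0.
apply: eq_n_comp; apply: eq_connect => d k.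
by rewrite /circles_rel /circle_rel /smoothed /=; case: (d.1 \in H).
Qed.

End Circles.

(** * Expansion of the bracket over states, sorted by balanced subgraphs *)

Section Bracket.
Variables (K : fieldType) (A : K) (D : diagram).
Hypothesis A_neq0 : A != 0.

Lemma bracket_rec_sum (cs : seq (crossing D)) (s : crossing D -> bool) : uniq cs ->
  bracket_rec A cs s
  = \sum_(H : {set crossing D} | H \subset [set c in cs])
      A ^ (2 * #|H|%:Z - (size cs)%:Z)
      * (- A ^+ 2 - A ^- 2)
        ^+ (state_circles (fun c => if c \in cs then c \in H else s c)).-1.
Proof.
elim: cs s => [|c cs IHcs] s /=.
  move=> _; have -> : [set c in [::]] = set0 :> {set crossing D}.
    by apply/setP => c; rewrite !inE.
  rewrite (big_pred1 set0) => [|H]; last by rewrite subset0.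
  by rewrite cards0 mul1r.
case/andP=> ccs ucs; rewrite (@sum_subsetsD1 _ _ _ c) ?inE ?eqxx //.
have -> : [set c0 in c :: cs] :\ c = [set c in cs].
  by apply/setP => c'; rewrite !inE; case: eqVneq => // ->; rewrite (negbTE ccs).
(* The A-smoothing of [c] corresponds to the sets containing [c], the second half of the sum, hence
   the exchange. *)
rewrite big_split /= addrC !IHcs // !mulr_sumr; congr (_ + _);
    apply: eq_bigr => H sH;
    have cH : c \notin H by apply: contra ccs => /(subsetP sH); rewrite inE.
  have sE : (fun c' => if c' \in cs then c' \in H else [eta s with c |-> true] c')
      =1 (fun c' => if c' \in c :: cs then c' \in c |: H else s c').
    by move=> c'; rewrite !inE /=; case: eqVneq => [->|_] //=; rewrite ?(negbTE ccs).
  rewrite (eq_state_circles sE) mulrA cardsU1 cH; congr (_ * _).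
  have -> : 2 * (true + #|H|)%N%:Z - (size cs).+1%:Z = 2 * #|H|%:Z - (size cs)%:Z + 1 by lia.
  by rewrite (expfzDr _ 1) // expr1z mulrC.
have sE : (fun c' => if c' \in cs then c' \in H else [eta s with c |-> false] c')
    =1 (fun c' => if c' \in c :: cs then c' \in H else s c').
  move=> c'; rewrite inE /=; case: eqVneq => [->|_] //=.
  by rewrite (negbTE ccs) (negbTE cH).
rewrite (eq_state_circles sE) mulrA; congr (_ * _).
have -> : 2 * #|H|%:Z - (size cs).+1%:Z = 2 * #|H|%:Z - (size cs)%:Z - 1 by lia.
by rewrite (expfzDr _ (- 1)) // exprN1 mulrC.
Qed.

Hypothesis altD : alternating_diagram D.
Hypotheses (D_joined : n_comp (@joined D) predT = 1%N)
  (D_null : null_circles D = 0%N) (D_essential : essential_circles D = 0%N).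

Let delta : K := - A ^+ 2 - A ^- 2.

Lemma bracket_sum :
  bracket A D = \sum_(H : {set crossing D})
    A ^ (2 * #|H|%:Z - #|crossing D|%:Z) * delta ^ ((circles true H)%:Z - 1).
Proof.
rewrite /bracket bracket_rec_sum ?enum_uniq // -cardE.
apply: eq_big => [H|H _]; first by apply/subsetP => c _; rewrite inE mem_enum.
rewrite (@eq_state_circles _ _ (fun c => c \in H)) => [|c]; last by rewrite mem_enum.
rewrite (state_circles_set D_essential _ D_null); congr (_ * _).
(* There is at least one circle, so the truncated predecessor is the integer difference. *)
by have := circles_gt0 D_joined true H; case: (circles true H) => // n _;
  have -> : n.+1%:Z - 1 = n%:Z by lia.
Qed.

Hypothesis D_nonlocal : ~ local_link D.

Variables black_p black_m : dart D -> bool.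
Hypothesis black_pE : forall k, black_p k = (is_over k == true).
Hypothesis black_mE : forall k, black_m k = (is_over k == false).
Hypothesis delta_neq0 : delta != 0.

(** For [H] balanced, the lifted pieces are twice the pieces, and the circle formula of
    [circles_pieces] becomes the exponent in [state_term]. *)
Lemma state_term_circles (x : K) b black (H : {set crossing D}) :
    (forall k, black k = (is_over k == b)) -> balanced (tait black) H ->
  state_term x (tait black) H
  = x ^ (2 * #|H|%:Z - #|crossing D|%:Z)
    * (- x ^+ 2 - x ^- 2) ^ ((circles b H)%:Z - 1).
Proof.
move=> blackE bal; rewrite /state_term bal cardsT; congr (_ * _ ^ _).
have [||c _ _] := @circles_pieces D altD b H _ (pieces_lift_setT D_joined D_essential D_nonlocal b).
- by rewrite pieces_joined.
- have [_] := circles_euler altD D_joined D_essential D_nonlocal; case: b {blackE} => [->//|].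
  have -> : circles false [set: crossing D] = circles true set0 := circles_setT D false.
  by have [+ _] := circles_euler altD D_joined D_essential D_nonlocal; lia.
rewrite (tait_card_vertices altD blackE) (tait_components altD blackE).
by move: bal c; rewrite (tait_balanced altD blackE) => /eqP->; lia.
Qed.

(** The states balanced in G_+ give the first sum. The complements of the others are exactly the
    balanced subgraphs of G_-; taking complements negates the exponent of [A], and [delta] is
    invariant under inverting [A]. *)
Lemma bracket_state_sums :
  bracket A D = state_sum A (tait black_p) + state_sum A^-1 (tait black_m).
Proof.
have deltaV : - A^-1 ^+ 2 - A^-1 ^- 2 = delta.
  by rewrite /delta !exprVn invrK addrC.
have sumT x black : state_sum x (tait black) =
    \sum_(H : {set crossing D} | balanced (tait black) H) state_term x (tait black) H.
  rewrite /state_sum [RHS]big_mkcond; apply: eq_big => [H|H _]; first by rewrite subsetT.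
  by rewrite /state_term; case: ifP.
rewrite bracket_sum (bigID (balanced (tait black_p))) !sumT /=; congr (_ + _).
  by apply: eq_bigr => H /(state_term_circles A black_pE) ->.
rewrite (reindex_inj (inv_inj (@setCK _))) /=.
have balC H : balanced (tait black_p) (~: H) = ~~ balanced (tait black_m) H.
  rewrite (tait_balanced altD black_pE) (tait_balanced altD black_mE).
  have := @exactly_one_balanced D altD true (~: H).
  rewrite /= setCK; apply=> [a|a|].
  - by rewrite pieces_joined.
  - exact: pieces_lift_setT.
  by have [_ ->] := circles_euler altD D_joined D_essential D_nonlocal.
apply: eq_big => [H|H balH]; first by rewrite balC negbK.
rewrite (state_term_circles _ black_mE); last by rewrite balC negbK in balH.
rewrite deltaV -(circlesC false); congr (_ * _).
rewrite exprz_inv; congr (_ ^ _).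
by rewrite -(cardsC H); lia.
Qed.

(** Both Tait graphs are connected, so the power of [delta] in [state_sum_myopic_tutte] is
    trivial. *)
Lemma bracket_myopic_tutte psi_p psi_m :
    myopic_tutte (tait black_p) psi_p -> myopic_tutte (tait black_m) psi_m ->
  bracket A D
  = A ^ (2 * #|vertices (tait black_p)|%:Z - #|crossing D|%:Z - 2)
      * eval2 psi_p (- A ^- 4) (- A ^+ 4)
    + A ^ (- (2 * #|vertices (tait black_m)|%:Z - #|crossing D|%:Z - 2))
      * eval2 psi_m (- A ^+ 4) (- A ^- 4).
Proof.
have deltaV : - A^-1 ^+ 2 - A^-1 ^- 2 = delta.
  by rewrite /delta !exprVn invrK addrC.
have sumE (x : K) b (black : dart D -> bool) psi : (forall k, black k = (is_over k == b)) ->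
    x != 0 -> - x ^+ 2 - x ^- 2 != 0 -> myopic_tutte (tait black) psi ->
    state_sum x (tait black)
    = x ^ (2 * #|vertices (tait black)|%:Z - #|crossing D|%:Z - 2)
      * eval2 psi (- x ^- 4) (- x ^+ 4).
  move=> blackE x0 dx psiP.
  have wf : ends_in_vertices (tait black) (edges (tait black)).
    exact: tait_ends_in_vertices.
  rewrite (state_sum_myopic_tutte x0 dx wf psiP).
  rewrite (tait_components altD blackE) pieces_joined // D_joined cardsT.
  by rewrite expr0z mulr1 mulr1.
move=> psi_pP psi_mP; rewrite bracket_state_sums.
rewrite (@sumE _ _ _ _ black_pE _ _ psi_pP) // (@sumE _ _ _ _ black_mE _ _ psi_mP).
- by rewrite exprz_inv !exprVn invrK.
- by rewrite invr_eq0.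
by rewrite deltaV.
Qed.

End Bracket.

(** Otherwise the diagram is a single crossingless circle; being nullhomologous, it is not
    essential, so it lies in the disk and the link is local. *)
Lemma connected_crossings (D : diagram) :
    connected_diagram D -> nullhomologous D -> ~ local_link D ->
  [/\ n_comp (@joined D) predT = 1%N, null_circles D = 0%N & essential_circles D = 0%N].
Proof.
rewrite /connected_diagram /pieces => conn null nonlocal.
suff n_gt0 : (0 < n_comp (@joined D) predT)%N by split; lia.
rewrite lt0n; apply/negP => /eqP n0; rewrite n0 in conn.
have no_dart (d : dart D) : False.
  have : (0 < n_comp (@joined D) predT)%N.
    by rewrite -(@pieces_joined D true) (n_comp_gt0 d) //; exact: pieces_rel_sym.
  by rewrite n0.
move: null; rewrite /nullhomologous.
have -> : [set d : dart D | flip d] = set0 by apply/setP => d; case: (no_dart d).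
rewrite cards0 => null; case: nonlocal; exists D; split; first exact: Relation_Operators.rst_refl.
split=> [d|]; first by case: (no_dart d).
by move: null conn; case: (essential_circles D) => [|[|n]] //; lia.
Qed.

Lemma checkerboard_over (D : diagram) (black : dart D -> bool) b :
    checkerboard black -> (forall c, black (c, 1) = b) ->
  forall k, black k = (is_over k == b).
Proof.
case=> _ black_ccw black1 [c i].
have black_cw k : black (cw k) = ~~ black k by rewrite -[k in RHS]cwK black_ccw negbK.
have : (c, i) \in [:: (c, 1); ccw (c, 1); cw (c, 1); opposite (c, 1)].
  exact: same_crossing.
by rewrite !inE => /or4P[]/eqP->; rewrite -?cw2_opposite ?black_cw ?black_ccw black1
  ?is_over_cw ?is_over_ccw; case: b {black1}.
Qed.

(** * Powers of t and the substitution A = t^(-1/4) *)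

Lemma tpow_quarters (n : nat) (z : int) :
  tpow n.+2 (z%:~R / 4%:R) = tpow n.+2 (- (1 / 4%:R)) ^ (- z).
Proof.
(* Two of the n + 2 factors 2 cancel the denominator 4, so the floor in [tpow] is taken of an
   integer. *)
have E (a : int) : a%:~R / 4%:R * 2%:R ^+ n.+2 = (a * 2 ^+ n)%:~R :> rat.
  by rewrite intrM rmorphXn /= !exprS; field.
have E1 : - (1 / 4%:R) = (-1)%:~R / 4%:R :> rat by field.
by rewrite /tpow E1 !E !intrKfloor exprz_exp mulN1r mulrNN mulrC.
Qed.

Lemma tpow_one (n : nat) : tpow n.+2 1 = tpow n.+2 (- (1 / 4%:R)) ^- 4.
Proof.
by have := tpow_quarters n 4; rewrite -exprnN => <-; congr tpow; rewrite divff.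
Qed.

Lemma tpow_nat (n : nat) : tpow n 1 = tofrac ('X^(2 ^ n)).
Proof.
rewrite /tpow mul1r; have -> : 2%:R ^+ n = (2 ^ n)%N%:~R :> rat by rewrite -natrX.
by rewrite intrKfloor rmorphXn.
Qed.

Lemma tpow_neq0 (n : nat) (k : rat) : tpow n k != 0.
Proof. by rewrite expfz_neq0 // tofrac_eq0 polyX_eq0. Qed.

(** The loop value is - A^2 (1 + A^-4), and A^-4 is t. *)
Lemma loop_value_neq0 (K : fieldType) (A : K) :
  A != 0 -> A ^- 4 != -1 -> - A ^+ 2 - A ^- 2 != 0.
Proof.
move=> A0; apply: contraNneq => loop0.
have -> : A ^- 4 = -1 - A ^- 2 * (- A ^+ 2 - A ^- 2) by field.
by rewrite loop0 mulr0 subr0.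
Qed.

Lemma tpow_one_neqN1 (n : nat) : tpow n 1 != -1.
Proof.
(* Evaluation at 1 would give 1 = -1 in the integers. *)
rewrite tpow_nat -tofrac1 -tofracN tofrac_eq; apply/eqP => /(congr1 (horner^~ 1)).
by rewrite hornerXn hornerN hornerC expr1n.
Qed.

Lemma writhe_factor (K : fieldType) (A : K) (w : int) :
  A != 0 -> (- A ^+ 3) ^ (- w) = (-1) ^ w * A ^ (- (3 * w)).
Proof.
move=> A0; rewrite -[- A ^+ 3]mulN1r exprzMl ?unitfE ?expf_neq0 ?oppr_eq0 ?oner_neq0 //.
by rewrite -[(-1) ^ (- _)]exprz_inv invrN1 -[A ^+ 3]/(A ^ 3) exprz_exp mulrN.
Qed.

Lemma jones_myopic_tutte (K : fieldType) (A : K) (D : diagram)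
    (o black_p black_m : dart D -> bool) (psi_p psi_m : {poly {poly int}}) :
    A != 0 -> - A ^+ 2 - A ^- 2 != 0 -> alternating_diagram D ->
    n_comp (@joined D) predT = 1%N -> null_circles D = 0%N ->
    essential_circles D = 0%N -> ~ local_link D ->
    (forall k, black_p k = (is_over k == true)) ->
    (forall k, black_m k = (is_over k == false)) ->
    myopic_tutte (tait black_p) psi_p -> myopic_tutte (tait black_m) psi_m ->
  jones A o
  = (-1) ^ writhe o
    * (A ^ (- (3 * writhe o
               - (2 * #|vertices (tait black_p)|%:Z - #|crossing D|%:Z - 2)))
         * eval2 psi_p (- A ^- 4) (- A ^+ 4)
       + A ^ (- (3 * writhe o
                 + (2 * #|vertices (tait black_m)|%:Z - #|crossing D|%:Z - 2)))
         * eval2 psi_m (- A ^+ 4) (- A ^- 4)).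
Proof.
move=> A0 loop0 altD joined1 null0 ess0 nonlocal black_pE black_mE psi_pP psi_mP.
rewrite /jones (bracket_myopic_tutte A0 altD joined1 null0 ess0 nonlocal
  black_pE black_mE loop0 psi_pP psi_mP) writhe_factor //.
rewrite -mulrA mulrDr !mulrA -!expfzDr //; congr (_ * (_ ^ _ * _ + _ ^ _ * _)).
  by rewrite opprB addrC.
by rewrite [RHS]opprD.
Qed.

Theorem theorem1p2 (D : diagram) (o black_p black_m : dart D -> bool) :
  orientation o ->
  connected_diagram D -> reduced D -> alternating_diagram D ->
  nullhomologous D -> ~ split_link D -> ~ local_link D ->
  (* the Tait graphs of black_p and black_m are G_+ and G_- *)
  checkerboard black_p -> (forall c, edge_positive black_p c) ->
  checkerboard black_m -> (forall c, ~~ edge_positive black_m c) ->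
  exists kp km : rat,
    [/\ dyadic kp, dyadic km, kp - km = 1 / 2%:R &
      forall (m : nat) (psi_p psi_m : {poly {poly int}}),
        (2 <= m)%N ->
        kp * 2%:R ^+ m \is a Num.int -> km * 2%:R ^+ m \is a Num.int ->
        myopic_tutte (tait black_p) psi_p ->
        myopic_tutte (tait black_m) psi_m ->
        let t := tpow m 1 in
        jones (tpow m (- (1 / 4%:R))) o
        = (-1) ^ writhe o
          * (tpow m kp * eval2 psi_p (- t) (- t^-1)
             + tpow m km * eval2 psi_m (- t^-1) (- t))].
Proof.
move=> _ conn _ altD null _ nonlocal chk_p pos_p chk_m pos_m.
have [joined1 null0 ess0] := connected_crossings conn null nonlocal.
have black_pE := checkerboard_over chk_p pos_p.
have black_mE := checkerboard_over chk_m (fun c => negbTE (pos_m c)).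
have [euler _] := circles_euler altD joined1 ess0 nonlocal.
rewrite -(tait_card_vertices altD black_pE) -(tait_card_vertices altD black_mE) in euler.
(* As t = A^-4, these negatives of the exponents of A in [jones_myopic_tutte] are four times the
   exponents of t. *)
pose zp : int := 3 * writhe o - (2 * #|vertices (tait black_p)|%:Z - #|crossing D|%:Z - 2).
pose zm : int := 3 * writhe o + (2 * #|vertices (tait black_m)|%:Z - #|crossing D|%:Z - 2).
have dyadic_quarter (z : int) : dyadic (z%:~R / 4%:R).
  by exists 2%N; rewrite -[_ * _]/(z%:~R / 4%:R * 4%:R) divfK.
exists (zp%:~R / 4%:R), (zm%:~R / 4%:R); split=> //.
  (* The difference is 2E + 4 - 2 (V_+ + V_-), with V_+ + V_- = E + 1 by [euler]. *)
  have zpE : zp = zm + 2 by rewrite /zp /zm; lia.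
  by rewrite zpE intrD; field.
move=> [|[|n]] // psi_p psi_m _ _ _ psi_pP psi_mP /=.
rewrite !tpow_quarters tpow_one invrK.
have := tpow_one_neqN1 n.+2; rewrite tpow_one.
move: (tpow n.+2 _) (tpow_neq0 n.+2 (- (1 / 4%:R))) => A A_neq0 A4.
exact: (jones_myopic_tutte o A_neq0 (loop_value_neq0 A_neq0 A4) altD joined1 null0
  ess0 nonlocal black_pE black_mE psi_pP psi_mP).
Qed.
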